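(* Let $(S_1,S_2,P)$ be a $\Gamma_3$-contraction on a Hilbert space $\mathcal H$ whose fundamental operator pair $(A_1,A_2)$ is commuting, i.e. $A_1A_2=A_2A_1$. Below, $I$ denotes the identity on $\mathcal D_P$, and $r(A_1)$ the spectral radius of $A_1$. Then: (i) $\left(\bar a I-aA_2^*\right)\left(aI-\bar a A_2\right)\le \left((1+|a|^2)I-aA_1^*\right)\left((1+|a|^2)I-\bar a A_1\right)$ for all $a\in\overline{\mathbb D}$; (ii) if $r(A_1)\le 2$, then $\left\|(aI-\bar a A_2)\left((1+|a|^2)I-\bar a A_1\right)^{-1}\right\|\le 1$ for all $a\in\mathbb D$. Moreover, if $r(A_1)\le 2$ and the inequality in (ii) is strict (for all $a\in\mathbb D$), then for every automorphism $\tau=\tau_m$ of $\mathbb G_3$, where $m(z)=\beta\frac{z-a}{1-\bar a z}$ with $a\in\mathbb D$, $\beta\in\mathbb T$, there exists a unitary $\mathcal U:\mathcal D_{P_\tau}\to\mathcal D_P$ such that the fundamental operator pair $(A_{1\tau},A_{2\tau})$ of the $\Gamma_3$-contraction $(S_{1\tau},S_{2\tau},P_\tau)=\tau(S_1,S_2,P)$ is given by $$A_{1\tau}=\mathcal U^*T^{-1/2}\beta\Big((1+3|a|^2)A_1+a^2(3+|a|^2)A_1^*-2\bar a A_2-2a^3A_2^*-a(1+|a|^2)(A_1^*A_1-A_2^*A_2)-3a(1+|a|^2)I\Big)T^{-1/2}\mathcal U,$$ $$A_{2\tau}=\mathcal U^*T^{-1/2}\beta^2\Big(-2(aA_1+a^3A_1^*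 )+A_2+a^4A_2^*+a^2(A_1^*A_1-A_2^*A_2)+3a^2I\Big)T^{-1/2}\mathcal U,$$ where $$T=(1+|a|^2+|a|^4)I-(1+|a|^2)(aA_1^*+\bar aA_1)+(a^2A_2^*+\bar a^2A_2)+|a|^2(A_1^*A_1-A_2^*A_2).$$
   Context: $\mathbb D$ is the open unit disc in $\mathbb C$, $\overline{\mathbb D}$ its closure, and $\mathbb T$ the unit circle. Operators are bounded linear operators on complex Hilbert spaces. Let $\pi_3(z_1,z_2,z_3)=(z_1+z_2+z_3,\;z_1z_2+z_1z_3+z_2z_3,\;z_1z_2z_3)$. The open and closed symmetrized tridisc are $\mathbb G_3=\pi_3(\mathbb D^3)$ and $\Gamma_3=\pi_3(\overline{\mathbb D}^3)$. A compact set $X\subset\mathbb C^n$ is a spectral set for a commuting tuple $\underline T=(T_1,\dots,T_n)$ of operators if the Taylor joint spectrum $\sigma(\underline T)$ is contained in $X$ and $\|f(\underline T)\|\le\sup_{x\in X}|f(x)|$ for every rational function $f$ with poles off $X$. A $\Gamma_3$-contraction is a commuting triple $(S_1,S_2,P)$ of operators on a Hilbert space $\mathcal H$ for which $\Gamma_3$ is a spectral set. For a contraction $P$, $D_P=(I-P^*P)^{1/2}$ and $\mathcal D_P=\overline{\operatorname{Ran}}\,D_P$. It is known that for every $\Gamma_3$-contraction $(S_1,S_2,P)$, $P$ is a contraction and there is a unique pair $(A_1,A_2)$ of operators on $\mathcal D_P$ such that $$S_1-S_2^*P=D_PA_1D_P,\qquad S_2-S_1^*P=D_PA_2D_P;$$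 this is called the fundamental operator pair of $(S_1,S_2,P)$. It is known that every automorphism (biholomorphic self-map) $\tau$ of $\mathbb G_3$ has the form $\tau=\tau_m$, where $\tau_m(\pi_3(z_1,z_2,z_3))=\pi_3(m(z_1),m(z_2),m(z_3))$ and $m(z)=\beta\frac{z-a}{1-\bar az}$ for some $a\in\mathbb D$, $\beta\in\mathbb T$. Such a $\tau$ extends holomorphically to a neighbourhood of $\Gamma_3$ and maps $\Gamma_3$ to itself, so $\tau(S_1,S_2,P)=(S_{1\tau},S_{2\tau},P_\tau)$ is defined by the holomorphic functional calculus and is again a $\Gamma_3$-contraction. Explicitly, with $R=(I-\bar aS_1+\bar a^2S_2-\bar a^3P)^{-1}$, $$S_{1\tau}=\beta\big((1+2|a|^2)S_1-\bar a(2+|a|^2)S_2+3\bar a^2P-3aI\big)R,$$ $$S_{2\tau}=\beta^2\big(-a(2+|a|^2)S_1+(1+2|a|^2)S_2-3\bar aP+3a^2I\big)R,$$ $$P_\tau=\beta^3\big(P-aS_2+a^2S_1-a^3I\big)R.$$ *)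

(* Defs.v *)
From HB Require Import structures.
From mathcomp Require Import all_boot all_order all_algebra.
From mathcomp Require Import complex.
From mathcomp Require Import all_classical all_reals topology normedtype.
(* The notations of mpoly.v clash with those of MathComp-Analysis. *)
From mathcomp Require Import -(notations) mpoly.

Set Implicit Arguments.
Unset Strict Implicit.
Unset Printing Implicit Defensive.

Import Order.TTheory GRing.Theory Num.Theory numFieldNormedType.Exports.

Local Open Scope classical_set_scope.
Local Open Scope ring_scope.

(* Complex Hilbert spaces. The inner product is linear in its first argument
   and conjugate-linear in the second. *)
HB.mixin Record isHilbert (R : realType) H & CompleteNormedModule R[i] H := {
  inner : {dot H for @Num.conj R[i]};
  sqr_normE : forall x : H, `|x| ^+ 2 = inner x x }.

#[short(type="hilbertType")]
HB.structure Definition Hilbert (R : realType) :=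
  {H of isHilbert R H & CompleteNormedModule R[i] H}.

Section ClosedSubspace.
Context (R : realType) (H : hilbertType R).

Record closedSubspace := ClosedSubspace {
  subspace_set : set H;
  subspace_set0 : subspace_set 0;
  subspace_setL : forall (c : R[i]) x y,
    subspace_set x -> subspace_set y -> subspace_set (c *: x + y);
  subspace_set_closed : closed subspace_set }.

Definition subspace_type (V : closedSubspace) := {x : H | x \in subspace_set V}.

End ClosedSubspace.

Coercion subspace_type : closedSubspace >-> Sortclass.

Section SubspaceHilbert.
Context (R : realType) (H : hilbertType R) (V : closedSubspace H).

HB.instance Definition _ := SubChoice.on (subspace_type V).

Let Vset : {pred H} := fun x => x \in subspace_set V.

Let Vset_submod : submod_closed Vset.
Proof.
split=> [|c x y]; rewrite /Vset /in_mem /= ?mem_setE.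
  by apply/mem_set; exact: subspace_set0.
by move=> /set_mem xV /set_mem yV; apply/mem_set; exact: subspace_setL.
Qed.

HB.instance Definition _ :=
  GRing.SubChoice_isSubLmodule.Build R[i] H Vset (subspace_type V) Vset_submod.

Local Notation W := (subspace_type V).
Let norm (x : W) : R[i] := `|val x|.

Let normD x y : norm (x + y) <= norm x + norm y.
Proof. exact: ler_normD. Qed.

Let normZ (l : R[i]) x : norm (l *: x) = `|l| * norm x.
Proof. exact: normrZ. Qed.

Let norm_eq0 x : norm x = 0 -> x = 0.
Proof. by move=> /eqP; rewrite normr_eq0 => /eqP x0; exact: val_inj. Qed.

HB.instance Definition _ :=
  Lmodule_isNormed.Build R[i] (subspace_type V) normD normZ norm_eq0.

Let subspace_complete (F : set_system (subspace_type V)) :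
  ProperFilter F -> cauchy F -> cvg F.
Proof.
move=> FF /cauchy_ballP Fc.
have ballE (x y : subspace_type V) e : ball x e y = ball (val x) e (val y).
  by rewrite -!ball_normE.
have Gc : cauchy (val @ F).
  apply/cauchy_ballP => e /Fc[[A B] [/= FA FB] AB].
  exists (val @` A, val @` B) => /=.
    by split; [apply: filterS FA|apply: filterS FB] => x Xx; exists x.
  by move=> [_ _] [/= [x Ax <-] [y By <-]]; rewrite -ballE; exact: (AB (x, y)).
have [l Fl] := (cvg_ex (val @ F)).1 (cauchy_cvg (val @ F) Gc).
have Vl : l \in subspace_set V.
  apply/mem_set/subspace_set_closed => U /Fl FU.
  have {FU} : F (val @^-1` U) by [].
  by move=> /filter_ex[x Ux]; exists (val x); split=> //; exact/set_mem/(valP x).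
apply/cvg_ex; exists (exist _ l Vl : subspace_type V).
apply/cvg_ballP => e e0.
have /cvg_ballP/(_ e e0) := Fl.
by apply: filterS => x; rewrite /= ballE.
Qed.

HB.instance Definition _ :=
  Uniform_isComplete.Build (subspace_type V) subspace_complete.

Definition subspace_inner (x y : subspace_type V) : R[i] :=
  inner (val x) (val y).

Let valB (x y : subspace_type V) : val (x - y) = val x - val y.
Proof. by []. Qed.
Let valZ c (x : subspace_type V) : val (c *: x) = c *: val x.
Proof. by []. Qed.
Let ip_addl u' : zmod_morphism (subspace_inner ^~ u').
Proof. by move=> x y; rewrite /subspace_inner valB linearBl. Qed.
Let ip_addr u : zmod_morphism (subspace_inner u).
Proof. by move=> x y; rewrite /subspace_inner valB linearBr. Qed.
Let ip_scalel u' : GRing.scalable_for *%R (subspace_inner ^~ u').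
Proof. by move=> c x; rewrite /subspace_inner valZ linearZl_LR. Qed.
Let ip_scaler u : GRing.scalable_for (@Num.conj R[i] \; *%R) (subspace_inner u).
Proof. by move=> c x; rewrite /subspace_inner valZ linearZr_LR. Qed.

HB.instance Definition _ := isBilinear.Build R[i] (subspace_type V)
  (subspace_type V) R[i] *%R (@Num.conj R[i] \; *%R) subspace_inner
  ip_addl ip_addr ip_scalel ip_scaler.

Let ip_herm (x y : subspace_type V) :
  subspace_inner x y = (-1) ^+ false * Num.conj (subspace_inner y x).
Proof. exact: hermitian_subproof. Qed.

HB.instance Definition _ := isHermitianSesquilinear.Build R[i]
  (subspace_type V) false (@Num.conj R[i]) subspace_inner ip_herm.

Let ip_pos (x : subspace_type V) : x != 0 -> 0 < subspace_inner x x.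
Proof. by move=> x0; exact: neq0_dnorm_gt0. Qed.

HB.instance Definition _ := isDotProduct.Build R[i]
  (subspace_type V) subspace_inner ip_pos.

Let sqr_val_norm (x : subspace_type V) : `|x| ^+ 2 = subspace_inner x x.
Proof. exact: (sqr_normE (val x)). Qed.

HB.instance Definition _ :=
  isHilbert.Build R (subspace_type V) sqr_val_norm.

End SubspaceHilbert.

Section Operators.
Context (R : realType).
Local Notation C := R[i].
Implicit Types H K : hilbertType R.

Definition bounded_linear H K (A : H -> K) := linear A /\ continuous A.

(* Operators are represented by plain functions. The adjoint, the inverse and
   the positive square root are total, with value 0 where none exists. *)
Definition adj H K (A : H -> K) : K -> H :=
  xget 0 [set B | bounded_linear B /\
                  forall x y, inner (A x) y = inner x (B y)].

Definition is_inverse H K (A : H -> K) (B : K -> H) :=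
  [/\ bounded_linear B, B \o A = idfun & A \o B = idfun].

Definition invertible H K (A : H -> K) := exists B, is_inverse A B.

Definition inv_op H K (A : H -> K) : K -> H := xget 0 [set B | is_inverse A B].

Definition opnorm H K (A : H -> K) : R :=
  sup [set complex.Re `|A x| | x in [set x : H | `|x| <= 1]].

Definition spectrum H (A : H -> H) : set C :=
  [set z | ~ invertible (A - z *: idfun)].

Definition spectral_radius H (A : H -> H) : R :=
  sup [set complex.Re `|z| | z in spectrum A].

(* The order of R[i] makes 0 <= z mean that z is real and nonnegative. *)
Definition positive_op H (A : H -> H) :=
  bounded_linear A /\ forall x, 0 <= inner (A x) x.

Definition loewner_le H (A B : H -> H) := positive_op (B - A).

Definition sqrt_op H (A : H -> H) : H -> H :=
  xget 0 [set B | positive_op B /\ B \o B = A].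

Definition unitary H K (U : H -> K) :=
  [/\ bounded_linear U, adj U \o U = idfun & U \o adj U = idfun].

Lemma sqrt_op_linear H (A : H -> H) : linear (sqrt_op A).
Proof.
rewrite /sqrt_op; case: xgetP => [B _ [[[linB _] _] _] //|_] c x y.
by rewrite /= scaler0 addr0.
Qed.

Section ClosedRange.
Context H K (A : H -> K) (linA : linear A).

Let closed_range0 : closure (range A) 0.
Proof.
apply: subset_closure; exists 0 => //.
by have := linA (-1) 0 0; rewrite scaler0 addr0 scaleN1r addNr.
Qed.

Let closed_rangeL (c : C) x y :
  closure (range A) x -> closure (range A) y -> closure (range A) (c *: x + y).
Proof.
move=> Ax Ay U /= Uxy.
have cont : (fun z : K * K => c *: z.1 + z.2) @ (x, y) --> c *: x + y.
  by apply: cvgD; [apply: cvgZl_tmp; exact: cvg_fst|exact: cvg_snd].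
have [[P Q] /= [Px Qy] PQ] := cont _ Uxy.
have [_ [[u _ <-] Pu]] := Ax _ Px; have [_ [[v _ <-] Qv]] := Ay _ Qy.
exists (A (c *: u + v)); split; first by exists (c *: u + v).
by rewrite linA; exact: (PQ (A u, A v)).
Qed.

Definition closed_range : closedSubspace K :=
  ClosedSubspace closed_range0 closed_rangeL (@closed_closure _ _).

End ClosedRange.

Definition defect_op H (P : H -> H) : H -> H := sqrt_op (idfun - (adj P \o P)).

Definition defect_space H (P : H -> H) : closedSubspace H :=
  closed_range (sqrt_op_linear (idfun - (adj P \o P))).

Lemma defect_op_subproof H (P : H -> H) x :
  defect_op P x \in subspace_set (defect_space P).
Proof. by apply/mem_set/subset_closure; exists x. Qed.

(* D_P as an operator from H into its defect space. *)
Definition defect_corestr H (P : H -> H) (x : H) : defect_space P :=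
  exist _ (defect_op P x) (defect_op_subproof P x).

(* The operator D_P A D_P on H, for an operator A on the defect space. *)
Definition defect_sandwich H (P : H -> H)
    (A : defect_space P -> defect_space P) : H -> H :=
  defect_op P \o val \o A \o defect_corestr P.

(* The total differential e_S (x) h |-> \sum_i (e_i /\ e_S) (x) T_i h of the
   Koszul complex of T on the exterior algebra of C^n tensored with H; x S is
   the coefficient in H of e_S. It is homogeneous of degree 1, so the complex
   is exact in every degree iff the kernel of koszul T is its range. *)
Definition koszul n H (T : 'I_n -> H -> H) (x : {set 'I_n} -> H) :
    {set 'I_n} -> H :=
  fun S => \sum_(i in S)
    (-1) ^+ #|[set j in S | (j < i)%N]| *: T i (x (S :\ i)).

Definition koszul_exact n H (T : 'I_n -> H -> H) :=
  forall x, koszul T x = 0 -> exists y, x = koszul T y.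

Definition taylor_spectrum n H (T : 'I_n -> H -> H) : set ('I_n -> C) :=
  [set z | ~ koszul_exact (fun i => T i - z i *: idfun)].

Definition mpoly_op n H (T : 'I_n -> H -> H) (p : mpoly n C) : H -> H :=
  \sum_(m <- msupp p) mcoeff m p *:
     \big[(fun A B : H -> H => A \o B)/idfun]_(i < n) iter (m i) (T i).

(* X is meant to be compact, so that the supremum is that of a bounded set.
   A rational function with poles off X is p / q with q zero-free on X, and
   f(T) is p(T) q(T)^-1; the invertibility of q(T), which also follows from the
   spectral mapping theorem, is recorded because f(T) presupposes it. *)
Definition spectral_set n H (X : set ('I_n -> C)) (T : 'I_n -> H -> H) :=
  [/\ forall i, bounded_linear (T i),
      forall i j, T i \o T j = T j \o T i,
      taylor_spectrum T `<=` X &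
      forall p q : mpoly n C, (forall x, X x -> meval x q != 0) ->
        invertible (mpoly_op T q) /\
        opnorm (mpoly_op T p \o inv_op (mpoly_op T q)) <=
          sup [set complex.Re `|meval x p / meval x q| | x in X]].

Definition pi3 (z1 z2 z3 : C) : 'I_3 -> C :=
  tnth [tuple z1 + z2 + z3; z1 * z2 + z1 * z3 + z2 * z3; z1 * z2 * z3].

Definition Gamma3 : set ('I_3 -> C) :=
  [set w | exists z1 z2 z3,
     [/\ `|z1| <= 1, `|z2| <= 1, `|z3| <= 1 & w = pi3 z1 z2 z3]].

Definition Gamma3_contraction H (S1 S2 P : H -> H) :=
  spectral_set Gamma3 (tnth [tuple S1; S2; P]).

Definition fundamental_pair H (S1 S2 P : H -> H)
    (A1 A2 : defect_space P -> defect_space P) :=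
  [/\ bounded_linear A1, bounded_linear A2,
      S1 - (adj S2 \o P) = defect_sandwich A1 &
      S2 - (adj S1 \o P) = defect_sandwich A2].

(* The image (S1tau, S2tau, Ptau) of (S1, S2, P) under the automorphism of the
   symmetrized tridisc induced by m(z) = b (z - a) / (1 - a^* z). *)
Section Automorphism.
Context H (a b : C) (S1 S2 P : H -> H).

Definition tau_denom : H -> H :=
  idfun - a^* *: S1 + a^* ^+ 2 *: S2 - a^* ^+ 3 *: P.

Definition tau1 : H -> H :=
  (b *: ((1 + 2 * `|a| ^+ 2) *: S1 - (a^* * (2 + `|a| ^+ 2)) *: S2
         + (3 * a^* ^+ 2) *: P - (3 * a) *: idfun)) \o inv_op tau_denom.

Definition tau2 : H -> H :=
  (b ^+ 2 *: ((- a * (2 + `|a| ^+ 2)) *: S1 + (1 + 2 * `|a| ^+ 2) *: S2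
              - (3 * a^*) *: P + (3 * a ^+ 2) *: idfun)) \o inv_op tau_denom.

Definition tau3 : H -> H :=
  (b ^+ 3 *: (P - a *: S2 + a ^+ 2 *: S1 - a ^+ 3 *: idfun))
    \o inv_op tau_denom.

End Automorphism.

End Operators.

Arguments fundamental_pair {R H} S1 S2 P A1 A2.

(* Main.v *)
Require Import Defs.
From HB Require Import structures.
From mathcomp Require Import all_boot all_order all_algebra.
From mathcomp Require Import complex.
From mathcomp Require Import all_classical all_reals topology normedtype.
From mathcomp Require Import -(notations) mpoly.
From mathcomp Require Import ring lra.

Set Implicit Arguments.
Unset Strict Implicit.
Unset Printing Implicit Defensive.

Import Order.TTheory GRing.Theory Num.Theory numFieldNormedType.Exports.

Local Open Scope classical_set_scope.
Local Open Scope ring_scope.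

(** Let [N = I - a^* S1 + a^*^2 S2 - a^*^3 P] and
    [M = P - a S2 + a^2 S1 - a^3 I], the values at the triple of the polynomials
    that send [pi_3(z)] to [prod (1 - a^* z_i)] and to [prod (z_i - a)]. For [a]
    in the open disc the first has no zero on Gamma_3 and dominates the second
    there, so, Gamma_3 being a spectral set, [N] is invertible and
    [|M x| <= |N x|] for all [x] ([Gamma3_vonNeumann]).

    Regard [D_P] as an operator [D] from the Hilbert space onto a dense subspace
    of the defect space. The fundamental equations give [D S1 = A1 D + A2^* D P]
    and [D S2 = A2 D + A1^* D P], whence, as [A1] and [A2] commute,
    [S1^* S1 - S2^* S2 = D^* (A1^* A1 - A2^* A2) D] ([pairQ_form]). Therefore
    all of [N^* N - M^* M] factors through [D]:
      [N^* N - M^* M = (1 - |a|^2) D^* T D]  ([pairT_transfer]),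
    and [T = X^* X - Y^* Y] with [X = (1 + |a|^2) I - a^* A1] and
    [Y = a I - a^* A2] ([pairT_form]). So [|Y z| <= |X z|] on the range of [D],
    hence everywhere by density, and for [|a| = 1] by continuity: this is (i).
    If the spectral radius of [A1] is at most 2 then [X] is invertible, since
    [(1 + |a|^2) / |a| > 2], and (ii) is (i) read through the inverse of [X].

    When the norm in (ii) is less than 1, [T] is coercive, hence invertible.
    With [R] the inverse of [N] and [P_tau = b^3 M R], the identity for
    [N^* N - M^* M] says that the defect operator of [P_tau] and
    [W = (1 - |a|^2)^(1/2) T^(1/2) D R] have the same norms on every vector;
    both have dense range, so a unitary [U] carries the first to the second
    ([unitary_extension]). The equations for the new fundamental pair reduce,
    after conjugation by [N], to identities of the same kind as that for
    [N^* N - M^* M] ([pairG1_transfer], [pairG2_transfer]), and density of the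
    range of the defect operator makes their solution unique.

    The operator theory that this rests on is proved from completeness: the
    projection theorem, adjoints by the Riesz representation theorem, the
    Lax-Milgram theorem, and the existence of positive square roots. *)

(** * Norms as real numbers, and completeness *)

Section RealNorm.
Context (R : realType).
Local Notation C := R[i].

(** The norms of the spaces at hand take their values in [R[i]], where the order
    is partial; all estimates are made on their real parts. *)
Definition nrm (V : normedZmodType C) (x : V) : R := complex.Re `|x|.

Lemma nrmE (V : normedZmodType C) (x : V) : `|x| = (nrm x)%:C%C.
Proof. by rewrite /nrm RRe_real // normr_real. Qed.

Section Zmod.
Context (V : normedZmodType C).
Implicit Types x y : V.

Lemma nrm_ge0 x : 0 <= nrm x.
Proof. by rewrite -ler0c -nrmE normr_ge0. Qed.

Lemma nrmD x y : nrm (x + y) <= nrm x + nrm y.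
Proof. by rewrite -lecR rmorphD /= -!nrmE ler_normD. Qed.

Lemma nrmN x : nrm (- x) = nrm x.
Proof. by rewrite /nrm normrN. Qed.

Lemma nrmB x y : nrm (x - y) = nrm (y - x).
Proof. by rewrite -nrmN opprB. Qed.

Lemma nrmBD x y z : nrm (x - z) <= nrm (x - y) + nrm (y - z).
Proof. by rewrite (le_trans _ (nrmD _ _))// addrA subrK. Qed.

Lemma nrm0 : nrm (0 : V) = 0.
Proof. by rewrite /nrm normr0. Qed.

Lemma nrm_eq0 x : nrm x = 0 -> x = 0.
Proof. by move=> x0; apply/eqP; rewrite -normr_eq0 nrmE x0. Qed.

Lemma nrm_gt0 x : (0 < nrm x) = (x != 0).
Proof.
rewrite lt_def nrm_ge0 andbT; congr (~~ _); apply/eqP/eqP => [/nrm_eq0//|->].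
exact: nrm0.
Qed.

Lemma nrm_small0 (M : R) x : (forall e : R, 0 < e -> nrm x <= M * e) -> x = 0.
Proof.
move=> small; apply: nrm_eq0; apply/eqP; rewrite eq_le nrm_ge0 andbT.
apply/ler_addgt0Pr => e e0; rewrite add0r.
have M0 : 0 < `|M| + 1 by rewrite ltr_pwDr.
apply: le_trans (small (e / (`|M| + 1)) _) _; first exact: divr_gt0.
rewrite mulrA ler_pdivrMr// mulrC ler_pM2l//.
by rewrite (le_trans (ler_norm M))// lerDl.
Qed.

End Zmod.

Lemma nrmZ (V : normedModType C) (c : C) (x : V) : nrm (c *: x) = nrm c * nrm x.
Proof.
by apply: complexI; rewrite rmorphM /= -!nrmE normrZ.
Qed.

Lemma nrm_real (t : R) : nrm t%:C%C = `|t|.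
Proof. by rewrite /nrm normc_def /= expr0n addr0 sqrtr_sqr. Qed.

Lemma nrmM (c d : C) : nrm (c * d) = nrm c * nrm d.
Proof. by apply: complexI; rewrite rmorphM /= -!nrmE normrM. Qed.

Lemma nrm_conj (c : C) : nrm c^* = nrm c.
Proof. by rewrite /nrm norm_conjC. Qed.

Lemma nrm1 : nrm (1 : C) = 1.
Proof. by rewrite /nrm normr1. Qed.

Lemma sqr_nrm (c : C) : ((nrm c) ^+ 2)%:C%C = c * c^*.
Proof. by rewrite rmorphXn /= -nrmE normCK. Qed.

Lemma Re_le_nrm (c : C) : complex.Re c <= nrm c.
Proof.
apply: le_trans (ler_norm _) _.
by rewrite /nrm normc_def /= -sqrtr_sqr ler_wsqrtr// lerDl sqr_ge0.
Qed.

Lemma le_nrm_sqr (V W : normedZmodType C) (x : V) (y : W) :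
  (nrm x ^+ 2 <= nrm y ^+ 2) = (nrm x <= nrm y).
Proof. by rewrite ler_pXn2r// nnegrE nrm_ge0. Qed.

Lemma closure_nrmP (V : normedModType C) (A : set V) (x : V) :
  closure A x <-> forall e : R, 0 < e -> exists2 y, A y & nrm (x - y) < e.
Proof.
split=> [Ax e e0|Ax U /nbhs_ballP[/= e e0 eU]].
  have eC : 0 < e%:C%C by rewrite ltcR.
  have [y [Ay]] := Ax _ (nbhsx_ballx x e%:C%C eC).
  by rewrite -ball_normE /= nrmE ltcR => xy; exists y.
have eR : e = (complex.Re e)%:C%C by rewrite RRe_real // gtr0_real.
have [|y Ay xy] := Ax (complex.Re e); first by rewrite -ltcR -eR.
by exists y; split=> //; apply: eU; rewrite -ball_normE /= eR nrmE ltcR.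
Qed.

(** Completeness in the only form used below: sets shrinking to diameter 0
    close down on a point. Whenever a limit is needed, it is found by taking
    for [B e] a set of [e]-approximations. *)
Lemma small_sets_limit (V : completeNormedModType C) (B : R -> set V) :
  (forall e, 0 < e -> B e !=set0) ->
  (forall d e x, 0 < d -> d <= e -> B d x -> B e x) ->
  (forall e x y, 0 < e -> B e x -> B e y -> nrm (x - y) <= e) ->
  exists l, forall e x, 0 < e -> B e x -> nrm (x - l) <= e.
Proof.
move=> B0 Bmono Bdiam.
pose F := filter_from [set e : R | 0 < e] B.
have FF : Filter F.
  apply: filter_from_filter; first by exists 1; rewrite /= ltr01.
  move=> d e /= d0 e0; exists (Num.min d e); first by rewrite lt_min d0.
  move=> x Bx; split; apply: Bmono Bx; rewrite ?lt_min ?d0//.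
    by rewrite ge_min lexx.
  by rewrite ge_min lexx orbT.
have FP : ProperFilter F by apply: filter_from_proper => // e /B0.
have cF : cauchy F.
  apply/cauchy_exP => /= e e0.
  have eR : e = (complex.Re e)%:C%C by rewrite RRe_real // gtr0_real.
  have e0' : 0 < complex.Re e by rewrite -ltcR -eR.
  have e2 : 0 < complex.Re e / 2 by rewrite divr_gt0.
  have [x Bx] := B0 _ e2; exists x; exists (complex.Re e / 2) => //= y By.
  rewrite -ball_normE /= eR nrmE ltcR.
  by apply: le_lt_trans (Bdiam _ _ _ e2 Bx By) _; lra.
have [l Fl] := (cvg_ex F).1 (cauchy_cvg F cF).
exists l => e x e0 Bx; apply/ler_addgt0Pr => d d0.
have dC : 0 < d%:C%C by rewrite ltcR.
have [c /= c0 cl] := Fl _ (nbhsx_ballx l d%:C%C dC).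
have me0 : 0 < Num.min c e by rewrite lt_min c0.
have [y By] := B0 _ me0.
have : ball l d%:C%C y by apply: cl; apply: Bmono By; rewrite // ge_min lexx.
rewrite -ball_normE /= nrmE ltcR nrmB => yl.
have Bey : B e y by apply: Bmono By; rewrite // ge_min lexx orbT.
have := Bdiam _ _ _ e0 Bx Bey; have := nrmBD x y l; lra.
Qed.

End RealNorm.

(** * Inner products and bounded operators *)

Section InnerProduct.
Context (R : realType) (H : hilbertType R).
Local Notation C := R[i].
Implicit Types (x y z : H) (c : C).

Lemma innerDl x y z : inner (x + y) z = inner x z + inner y z.
Proof. by rewrite linearDl. Qed.

Lemma innerBl x y z : inner (x - y) z = inner x z - inner y z.
Proof. by rewrite linearBl. Qed.

Lemma innerNl x y : inner (- x) y = - inner x y.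
Proof. by rewrite linearNl. Qed.

Lemma inner0l y : inner 0 y = 0.
Proof. by rewrite linear0l. Qed.

Lemma innerZl c x y : inner (c *: x) y = c * inner x y.
Proof. by rewrite linearZl_LR. Qed.

Lemma innerDr x y z : inner x (y + z) = inner x y + inner x z.
Proof. by rewrite linearDr. Qed.

Lemma innerBr x y z : inner x (y - z) = inner x y - inner x z.
Proof. by rewrite linearBr. Qed.

Lemma innerNr x y : inner x (- y) = - inner x y.
Proof. by rewrite linearNr. Qed.

Lemma inner0r x : inner x 0 = 0.
Proof. by rewrite linear0r. Qed.

Lemma innerZr c x y : inner x (c *: y) = c^* * inner x y.
Proof. by rewrite linearZr_LR. Qed.

Definition innerE := (innerDl, innerDr, innerBl, innerBr, innerNl, innerNr,
  inner0l, inner0r, innerZl, innerZr).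

Lemma innerC x y : (inner x y)^* = inner y x.
Proof. by rewrite [RHS]hermC expr0 mul1r. Qed.

Lemma inner_nrm x : inner x x = ((nrm x) ^+ 2)%:C%C.
Proof. by rewrite -sqr_normE nrmE -rmorphXn. Qed.

Lemma inner_eq0r x : (forall y, inner x y = 0) -> x = 0.
Proof.
move=> x0; apply: nrm_eq0; apply/eqP; rewrite -sqrf_eq0; apply/eqP.
by apply: complexI; rewrite -inner_nrm x0.
Qed.

Lemma inner_inj x y : (forall z, inner x z = inner y z) -> x = y.
Proof.
by move=> xy; apply/subr0_eq/inner_eq0r => z; rewrite innerBl xy subrr.
Qed.

Lemma inner_injr x y : (forall z, inner z x = inner z y) -> x = y.
Proof. by move=> xy; apply: inner_inj => z; rewrite -innerC xy innerC. Qed.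

Lemma nrm_sqrE x : nrm x ^+ 2 = complex.Re (inner x x).
Proof. by rewrite inner_nrm. Qed.

Lemma parallelogram x y :
  nrm (x + y) ^+ 2 + nrm (x - y) ^+ 2 = 2 * (nrm x ^+ 2 + nrm y ^+ 2).
Proof.
apply: complexI; rewrite mulr_natl rmorphMn !rmorphD /= -!inner_nrm !innerE.
by rewrite -mulr_natl; ring.
Qed.

End InnerProduct.

Section BoundedLinear.
Context (R : realType).
Local Notation C := R[i].

Lemma bounded_linearP (H K : hilbertType R) (A : H -> K) :
  bounded_linear A <->
  linear A /\ exists M : R, forall x, nrm (A x) <= M * nrm x.
Proof.
split=> -[linA cA]; split=> //; pose f := HB.pack_for {linear H -> K} A
    (GRing.isLinear.Build _ _ _ _ A linA).
  have : bounded_near f (nbhs 0) by apply/linear_bounded_continuous.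
  move=> /linear_boundedP[M [Mr]] /(_ (M + 1)); rewrite ltrDl => /(_ ltr01) fM.
  exists (complex.Re (M + 1)) => x; rewrite -lecR rmorphM /= -!nrmE.
  by rewrite RRe_real ?fM// realD.
case: cA => M AM.
have fb : bounded_near f (nbhs 0).
  apply/linear_boundedP; exists M%:C%C.
  split=> [|N MN x]; first by rewrite complex_real.
  rewrite (le_trans _ (ler_wpM2r (normr_ge0 x) (ltW MN)))//.
  by rewrite !nrmE -rmorphM lecR AM.
exact/(@linear_bounded_continuous _ _ _ f).
Qed.

Section Linear.
Context (H K : hilbertType R) (A : H -> K) (linA : linear A).

Lemma linD x y : A (x + y) = A x + A y.
Proof. by have := linA 1 x y; rewrite !scale1r. Qed.

Lemma lin0 : A 0 = 0.
Proof. by apply: (@addrI _ (A 0)); rewrite -linD !addr0. Qed.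

Lemma linZ c x : A (c *: x) = c *: A x.
Proof. by have := linA c x 0; rewrite lin0 !addr0. Qed.

Lemma linN x : A (- x) = - A x.
Proof. by rewrite -scaleN1r linZ scaleN1r. Qed.

Lemma linB x y : A (x - y) = A x - A y.
Proof. by rewrite linD linN. Qed.

End Linear.

Section Algebra.
Context (H K L : hilbertType R).

Lemma bounded_linear_comp (A : K -> L) (B : H -> K) :
  bounded_linear A -> bounded_linear B -> bounded_linear (A \o B).
Proof.
move=> [linA cA] [linB cB]; split; first by move=> c x y; rewrite /= linB linA.
by move=> x; apply: continuous_comp; [exact: cB|exact: cA].
Qed.

Lemma bounded_linear_id : bounded_linear (idfun : H -> H).
Proof. by split=> // x. Qed.

Lemma bounded_linearD (A B : H -> K) :
  bounded_linear A -> bounded_linear B -> bounded_linear (A + B).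
Proof.
move=> /bounded_linearP[linA [M AM]] /bounded_linearP[linB [N BN]].
apply/bounded_linearP; split.
  by move=> c x y; rewrite !fctE linA linB scalerDr addrACA.
exists (M + N) => x; rewrite fctE mulrDl.
by apply: le_trans (nrmD _ _) _; rewrite lerD.
Qed.

Lemma bounded_linearZ c (A : H -> K) :
  bounded_linear A -> bounded_linear (c *: A).
Proof.
move=> /bounded_linearP[linA [M AM]]; apply/bounded_linearP; split.
  by move=> d x y; rewrite !fctE linA scalerDr !scalerA mulrC.
by exists (nrm c * M) => x; rewrite fctE nrmZ -mulrA ler_wpM2l ?nrm_ge0.
Qed.

Lemma bounded_linearN (A : H -> K) :
  bounded_linear A -> bounded_linear (- A).
Proof.
by move=> bA; have := bounded_linearZ (-1) bA; rewrite scaleN1r.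
Qed.

Lemma bounded_linearB (A B : H -> K) :
  bounded_linear A -> bounded_linear B -> bounded_linear (A - B).
Proof. by move=> bA /bounded_linearN; exact: bounded_linearD. Qed.

End Algebra.
End BoundedLinear.

(** * Positive forms *)

Section PositiveForms.
Context (R : realType) (H : hilbertType R).
Local Notation C := R[i].
Implicit Types (x y z : H) (c : C) (A : H -> H).

Definition symmetric_op A := forall x y, inner (A x) y = inner x (A y).

Definition qform A x : R := complex.Re (inner (A x) x).

Lemma qformE A x : symmetric_op A -> inner (A x) x = (qform A x)%:C%C.
Proof.
by move=> sA; rewrite /qform RRe_real//; apply/CrealP; rewrite innerC sA.
Qed.

(** The quadratic form of [A] along the line through [x] in the direction
    [y], the direction being rotated so that the cross term is real. *)
Lemma qform_line A x y (t : R) : linear A -> symmetric_op A ->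
  let b := nrm (inner (A x) y) ^+ 2 in
  qform A (x - (t%:C%C * inner (A x) y) *: y) =
  qform A x - 2 * t * b + t ^+ 2 * (b * qform A y).
Proof.
move=> linA sA b; set s := (_ * _).
have bE : b%:C%C = inner (A x) y * (inner (A x) y)^* by rewrite /b sqr_nrm.
clearbody b; apply: complexI; rewrite -qformE//.
rewrite !(rmorphD, rmorphN, rmorphM)/= bE -!qformE//.
have sJ : s^* = t%:C%C * (inner (A x) y)^*.
  by rewrite rmorphM/= conj_Creal ?complex_real.
have yx : inner (A y) x = (inner (A x) y)^* by rewrite sA -innerC.
rewrite linB// linZ// !innerE sJ yx /s.
by ring.
Qed.

(** A real quadratic that is nonnegative everywhere has a nonpositive
    discriminant; dividing it by [b] leaves this statement, which holds for
    [b = 0] as well. *)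
Lemma discriminant_le (a b g : R) : 0 <= b -> 0 <= g ->
  (forall t : R, 0 <= a - 2 * t * b + t ^+ 2 * (b * g)) -> b <= a * g.
Proof.
move=> b0 g0 pos; have [g00|g1] := eqVneq g 0.
  rewrite g00 mulr0; rewrite leNgt; apply/negP => bp.
  have := pos ((a + 1) / (2 * b)); rewrite g00 !mulr0 addr0.
  have -> : 2 * ((a + 1) / (2 * b)) * b = a + 1 by field; rewrite gt_eqF.
  by lra.
have gp : 0 < g by rewrite lt_def g1.
have := pos g^-1.
have -> : a - 2 * g^-1 * b + g^-1 ^+ 2 * (b * g) = a - b / g by field.
by rewrite subr_ge0 ler_pdivrMr.
Qed.

(** The forms [inner (A x) y] need not be definite: the generality serves to
    bound [A x] by the quadratic form of [A], and to see that a symmetric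
    operator with zero quadratic form vanishes. *)
Lemma form_CauchySchwarz A x y : linear A -> symmetric_op A ->
  (forall z, 0 <= qform A z) ->
  nrm (inner (A x) y) ^+ 2 <= qform A x * qform A y.
Proof.
move=> linA sA pA; apply: discriminant_le => // [|t]; first exact: sqr_ge0.
by rewrite -qform_line.
Qed.

Lemma CauchySchwarz x y : nrm (inner x y) <= nrm x * nrm y.
Proof.
rewrite -(@ler_pXn2r _ 2)// ?nnegrE ?nrm_ge0 ?mulr_ge0 ?nrm_ge0//.
have q1 z : qform idfun z = nrm z ^+ 2 by rewrite nrm_sqrE.
rewrite exprMn -!q1; apply: (@form_CauchySchwarz idfun) => // z.
by rewrite q1 sqr_ge0.
Qed.

(** Over the complex numbers positivity includes the reality of the quadratic
    form. Its reality at [x + y] and at [x + i y] determines the sum and the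
    difference of [inner y (A x)] and [inner x (A y)] as those of
    [inner (A x) y] and [inner (A y) x]. *)
Lemma positive_sym A : positive_op A -> symmetric_op A.
Proof.
move=> [[linA _] pA] x y.
have realq z : (inner (A z) z)^* = inner (A z) z.
  by rewrite conj_Creal ?ger0_real.
have := realq (x + y); have := realq (x + 'i%R *: y).
rewrite !linD// linZ// !innerE !(rmorphD, rmorphM)/= !realq !conjCK !conjCi.
rewrite !innerC.
set u := inner (A x) y; set v := inner (A y) x.
move=> e1 e2.
have E1 : inner y (A x) + inner x (A y) = u + v.
  apply/eqP; rewrite -subr_eq0; apply/eqP.
  by move: e2 => /eqP; rewrite -subr_eq0 => /eqP <-; rewrite -/u -/v; ring.
have E2 : inner y (A x) - inner x (A y) = v - u.
  apply: (@mulfI _ 'i); first exact: neq0Ci.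
  apply/eqP; rewrite -subr_eq0; apply/eqP.
  by move: e1 => /eqP; rewrite -subr_eq0 => /eqP <-; rewrite -/u -/v; ring.
apply/eqP; rewrite -subr_eq0; apply/eqP.
have : 2 * (u - inner x (A y)) = 0.
  rewrite (_ : 2 * _ = (u + v - (inner y (A x) + inner x (A y)))
    - ((v - u) - (inner y (A x) - inner x (A y)))); last by ring.
  by rewrite E1 E2 !subrr.
by move/eqP; rewrite mulf_eq0 pnatr_eq0 /= => /eqP.
Qed.

Lemma positive_qform A x : positive_op A -> 0 <= qform A x.
Proof.
by move=> pA; rewrite -ler0c -qformE; [exact: pA.2|exact: positive_sym].
Qed.

End PositiveForms.

(** * Projections, adjoints and inverses *)

Section Projection.
Context (R : realType) (H : hilbertType R).
Local Notation C := R[i].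
Implicit Types (x y z : H).

(** By the parallelogram law, the points of [V] that almost realise the distance
    from [x] to [V] are close to each other, hence accumulate at a nearest
    point [l]; [x - l] is orthogonal to [V] because moving along [V] cannot
    shorten it. *)
Lemma projection (V : closedSubspace H) x :
  exists2 v, subspace_set V v &
    forall w, subspace_set V w -> inner (x - v) w = 0.
Proof.
pose E := [set nrm (x - v) ^+ 2 | v in subspace_set V].
have E0 : E !=set0 by exists (nrm (x - 0) ^+ 2), 0 => //; exact: subspace_set0.
have Elb : has_lbound E by exists 0 => _ [v _ <-]; exact: sqr_ge0.
pose d := inf E.
have dE v : subspace_set V v -> d <= nrm (x - v) ^+ 2.
  by move=> Vv; apply: ge_inf => //; exists v.
have d0 : 0 <= d by apply: lb_le_inf => // _ [v _ <-]; exact: sqr_ge0.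
have VD u v : subspace_set V u -> subspace_set V v -> subspace_set V (u + v).
  by move=> Vu Vv; have := subspace_setL 1 Vu Vv; rewrite scale1r.
have VZ c v : subspace_set V v -> subspace_set V (c *: v).
  by move=> Vv; have := subspace_setL c Vv (subspace_set0 V); rewrite addr0.
pose B e := [set v | subspace_set V v /\ nrm (x - v) ^+ 2 < d + e ^+ 2 / 4].
have [|e f v e0 ef [Vv vd]|e u v e0 [Vu ud] [Vv vd]|l lB] :=
    @small_sets_limit _ _ B.
- move=> e e0; have ee : 0 < e ^+ 2 / 4 by rewrite divr_gt0// exprn_gt0.
  have [_ [v Vv <-] vd] := inf_adherent ee (conj E0 Elb).
  by exists v.
- split=> //; apply: lt_le_trans vd _.
  have : e ^+ 2 <= f ^+ 2 by rewrite !expr2; nra.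
  lra.
- rewrite -(@ler_pXn2r _ 2)// ?nnegrE ?nrm_ge0 ?(ltW e0)//.
  (* The midpoint of u and v is in V, hence at squared distance >= d. *)
  have mid : 4 * d <= nrm ((x - u) + (x - v)) ^+ 2.
    have -> : (x - u) + (x - v) = (2 : C) *: (x - (2^-1 : C) *: (u + v)).
      rewrite scalerBr scalerA mulfV ?pnatr_eq0// scale1r scaler_nat mulr2n.
      by rewrite opprD addrACA.
    rewrite nrmZ exprMn.
    have -> : nrm (2 : C) = 2 :> R.
      by have := nrm_real (2 : R); rewrite rmorph_nat ger0_norm.
    by have := dE _ (VZ (2^-1) _ (VD _ _ Vu Vv)); lra.
  have := parallelogram (x - u) (x - v).
  have -> : x - u - (x - v) = v - u by rewrite opprB addrC addrA subrK.
  by rewrite nrmB; lra.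
have Bne e : 0 < e -> exists2 v, B e v & nrm (v - l) <= e.
  move=> e0; have ee : 0 < e ^+ 2 / 4 by rewrite divr_gt0// exprn_gt0.
  have [_ [v Vv <-] vd] := inf_adherent ee (conj E0 Elb).
  by exists v => //; exact: lB.
have Vl : subspace_set V l.
  apply: (@subspace_set_closed _ _ V); apply/closure_nrmP => e e0.
  have e2 : 0 < e / 2 by rewrite divr_gt0.
  have [v [Vv _] vl] := Bne _ e2.
  by exists v => //; rewrite nrmB; lra.
have xl : nrm (x - l) ^+ 2 <= d.
  have s0 := sqrtr_ge0 d; have sd := sqr_sqrtr d0; set s := Num.sqrt d in s0 sd.
  rewrite -sd ler_pXn2r// ?nnegrE ?nrm_ge0//.
  apply/ler_addgt0Pr => e e0; have e2 : 0 < e / 2 by rewrite divr_gt0.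
  have [v [Vv vd] vl] := Bne _ e2.
  have : nrm (x - v) <= s + e / 4.
    have se : 0 <= s + e / 4 by rewrite addr_ge0// divr_ge0// ltW.
    rewrite -(@ler_pXn2r _ 2)// ?nnegrE ?nrm_ge0//.
    by apply: le_trans (ltW vd) _; rewrite -sd; nra.
  by have := nrmBD x v l; lra.
exists l => // w Vw; apply: nrm_eq0; apply/eqP.
rewrite -sqrf_eq0 eq_le sqr_ge0 andbT -(mul0r (qform idfun w)).
have q1 z : qform idfun z = nrm z ^+ 2 by rewrite nrm_sqrE.
apply: discriminant_le => [||t]; rewrite ?q1 ?sqr_ge0//.
have := @qform_line _ _ idfun (x - l) w t (fun _ _ _ => erefl)
  (fun _ _ => erefl).
rewrite /= !q1 => E1.
have := dE _ (VD _ _ Vl (VZ (t%:C%C * inner (x - l) w) _ Vw)).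
by rewrite opprD addrA E1; lra.
Qed.

End Projection.

Section Riesz.
Context (R : realType).
Local Notation C := R[i].

(** A nonzero vector orthogonal to the kernel of [f] represents [f] up to
    scaling, since every [x] is a multiple of it modulo the kernel. *)
Lemma Riesz (H : hilbertType R) (f : H -> C) (M : R) :
  (forall (c : C) x y, f (c *: x + y) = c * f x + f y) ->
  (forall x, nrm (f x) <= M * nrm x) -> exists v, forall x, f x = inner x v.
Proof.
move=> linf fM.
have f0 : f 0 = 0.
  have := linf 1 0 0; rewrite scale1r addr0 mul1r => /eqP.
  by rewrite addrC -subr_eq subrr eq_sym => /eqP.
have fB x y : f (x - y) = f x - f y.
  by rewrite addrC -scaleN1r linf mulN1r addrC.
have kerL (c : C) x y : f x = 0 -> f y = 0 -> f (c *: x + y) = 0.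
  by move=> x0 y0; rewrite linf x0 y0 mulr0 addr0.
have kerC : closed [set x | f x = 0].
  move=> x /closure_nrmP xK; apply: (@nrm_small0 _ _ `|M|) => e e0.
  have [y /= y0 xy] := xK e e0.
  rewrite -(subr0 (f x)) -y0 -fB; apply: le_trans (fM _) _.
  apply: le_trans (ler_wpM2r (nrm_ge0 _) (ler_norm M)) _.
  by rewrite ler_wpM2l// ltW.
pose K := ClosedSubspace (f0 : [set x | f x = 0] 0) kerL kerC.
have [fz|/existsNP[x0 fx0]] := pselect (forall x, f x = 0).
  by exists 0 => x; rewrite inner0r.
have [v fv wK] := projection K x0; set w := x0 - v in wK.
have fw : f w != 0 by rewrite fB fv subr0; apply/eqP.
have ww : inner w w != 0.
  rewrite dnorm_eq0; apply: contra_neq fw => ->; exact: f0.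
exists (((f w)^* / inner w w) *: w) => x.
rewrite innerZr rmorphM/= conjCK fmorphV/= innerC.
have := wK (x - (f x / f w) *: w); rewrite /= fB.
have fZ c y : f (c *: y) = c * f y by rewrite -[c *: y]addr0 linf f0 addr0.
rewrite fZ divfK// subrr => /(_ erefl)/(congr1 Num.conj).
rewrite innerC rmorph0 innerBl innerZl => /eqP; rewrite subr_eq0 => /eqP ->.
by field; rewrite fw.
Qed.

Section Adjoint.
Context (H K : hilbertType R) (A : H -> K).

Definition is_adjoint (B : K -> H) := forall x y, inner (A x) y = inner x (B y).

Lemma is_adjointC B : is_adjoint B -> forall x y, inner (B x) y = inner x (A y).
Proof. by move=> AB x y; rewrite -innerC -AB innerC. Qed.

Lemma adjoint_bounded B M : 0 <= M -> (forall x, nrm (A x) <= M * nrm x) ->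
  is_adjoint B -> bounded_linear B.
Proof.
move=> M0 AM AB; apply/bounded_linearP; split=> [c x y|].
  by apply: inner_injr => z; rewrite -AB !innerE -!AB.
exists M => y; have [->|By0] := eqVneq (B y) 0.
  by rewrite nrm0 mulr_ge0// nrm_ge0.
rewrite -(@ler_pM2r _ (nrm (B y))) ?nrm_gt0// -expr2.
rewrite nrm_sqrE -AB (le_trans (_ : _ <= nrm (inner (A (B y)) y)))//.
  by rewrite -[X in X <= _]ger0_norm ?AB ?inner_nrm//= ?sqr_ge0// -nrm_real.
apply: le_trans (CauchySchwarz _ _) _.
by have := AM (B y); have := nrm_ge0 y; nra.
Qed.

Hypothesis bA : bounded_linear A.

Lemma bounded_ge0 : exists2 M : R, 0 <= M & forall x, nrm (A x) <= M * nrm x.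
Proof.
have [_ [M AM]] := (bounded_linearP A).1 bA; exists `|M| => // x.
by rewrite (le_trans (AM x))// ler_wpM2r ?nrm_ge0// ler_norm.
Qed.

Lemma adj_subproof : bounded_linear (adj A) /\ is_adjoint (adj A).
Proof.
have linA := bA.1; have [M M0 AM] := bounded_ge0.
rewrite /adj; case: xgetP => [B _ //|noB].
have /choice[B AB] : forall y, exists v, forall x, inner (A x) y = inner x v.
  move=> y; apply: (@Riesz _ _ (M * nrm y)) => [c x z|x].
    by rewrite linA innerDl innerZl.
  apply: le_trans (CauchySchwarz _ _) _.
  by rewrite mulrAC ler_wpM2r ?nrm_ge0.
have AB' : is_adjoint B by move=> x y; exact: AB.
by have [] := noB B; split=> //; exact: adjoint_bounded AM AB'.
Qed.

Lemma adj_bounded : bounded_linear (adj A). Proof. exact: adj_subproof.1. Qed.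

Lemma adjP x y : inner (A x) y = inner x (adj A y).
Proof. exact: adj_subproof.2. Qed.

Lemma adjPr x y : inner (adj A x) y = inner x (A y).
Proof. exact: (is_adjointC adj_subproof.2). Qed.

Lemma adj_unique B : is_adjoint B -> adj A = B.
Proof.
by move=> AB; apply/funext => y; apply: inner_injr => x; rewrite -adjP AB.
Qed.

End Adjoint.

Section Inverse.
Context (H K : hilbertType R).
Implicit Types (A : H -> K).

Lemma inv_opP A : invertible A -> is_inverse A (inv_op A).
Proof. by rewrite /inv_op; case: xgetP => [B _ //|noB] [B] /noB. Qed.

Lemma inv_opK A : invertible A -> cancel A (inv_op A).
Proof. by move=> /inv_opP[_ /(congr1 (@^~ _)) E _] x; exact: E. Qed.

Lemma inv_opVK A : invertible A -> cancel (inv_op A) A.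
Proof. by move=> /inv_opP[_ _ /(congr1 (@^~ _)) E] x; exact: E. Qed.

Lemma inv_op_bounded A : invertible A -> bounded_linear (inv_op A).
Proof. by case/inv_opP. Qed.

(** The lower bound makes [A] injective with closed range, and the range is
    everything because its orthogonal complement is zero. *)
Lemma bounded_below_invertible A (c : R) : bounded_linear A -> 0 < c ->
  (forall x, c * nrm x <= nrm (A x)) ->
  (forall y, (forall x, inner (A x) y = 0) -> y = 0) -> invertible A.
Proof.
move=> bA c0 cA rA; have linA := bA.1; have [M M0 AM] := bounded_ge0 bA.
have injA : injective A.
  move=> x y /eqP; rewrite -subr_eq0 -linB// => /eqP Axy.
  apply/subr0_eq/nrm_eq0/eqP; rewrite eq_le nrm_ge0 andbT.
  by rewrite -(pmulr_rle0 _ c0); have := cA (x - y); rewrite Axy nrm0.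
have rangeA y : closure (range A) y -> exists x, A x = y.
  move=> /closure_nrmP yA.
  pose B e := [set x | nrm (A x - y) < c * e / 2].
  have Bne e : 0 < e -> B e !=set0.
    move=> e0; have e1 : 0 < c * e / 2 by rewrite divr_gt0// mulr_gt0.
    by have [_ [x _ <-] xe] := yA _ e1; exists x; rewrite /B /= nrmB.
  have [//|d e x _ de|e x z e0|l lB] := @small_sets_limit _ _ B.
  - by rewrite /B /=; nra.
  - rewrite /B /= => xe ze; rewrite -(ler_pM2l c0).
    apply: le_trans (cA _) _; rewrite linB//.
    by have := nrmBD (A x) y (A z); rewrite (nrmB y); lra.
  exists l; apply/subr0_eq/(@nrm_small0 _ _ (c / 2 + M)) => e e0.
  have [x Bx] := Bne e e0; have := nrmBD (A l) (A x) y.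
  have := lB _ _ e0 Bx; rewrite (nrmB x) => xl.
  have := AM (l - x); rewrite linB// => Alx.
  by move: Bx; rewrite /B /=; have := ler_wpM2l M0 xl; lra.
have surjA z : exists x, A x = z.
  have [v vA vy] := projection (closed_range linA) z.
  apply: rangeA; suff -> : z = v by [].
  apply/subr0_eq/rA => x; rewrite -innerC vy ?rmorph0//.
  by apply: subset_closure; exists x.
have [g gK] := choice surjA.
exists g; split; last by apply/funext => x /=; rewrite gK.
  apply/bounded_linearP; split.
    by move=> k x y; apply: injA; rewrite linA !gK.
  by exists c^-1 => y; rewrite mulrC ler_pdivlMr// mulrC -[in leRHS](gK y).
by apply/funext => x /=; apply: injA; rewrite gK.
Qed.

End Inverse.

(** The Lax-Milgram theorem: by Cauchy-Schwarz, coercivity bounds [A] below and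
    kills every vector orthogonal to its range. *)
Lemma coercive_invertible (H : hilbertType R) (A : H -> H) (c : R) :
  bounded_linear A -> 0 < c ->
  (forall x, c * nrm x ^+ 2 <= nrm (inner (A x) x)) -> invertible A.
Proof.
move=> bA c0 cA; apply: (@bounded_below_invertible _ _ A c) => // [x|y yA].
  have [->|x0] := eqVneq x 0; first by rewrite nrm0 mulr0 nrm_ge0.
  rewrite -(@ler_pM2r _ (nrm x)) ?nrm_gt0// -mulrA -expr2.
  exact: le_trans (cA x) (CauchySchwarz _ _).
apply/nrm_eq0/eqP; rewrite -sqrf_eq0 eq_le sqr_ge0 andbT -(pmulr_rle0 _ c0).
by have := cA y; rewrite yA nrm0.
Qed.

End Riesz.

(** * Positive square roots *)

Section ContractionRoot.
Context (R : realType) (H : hilbertType R) (K : H -> H).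
Hypotheses (linK : linear K) (symK : symmetric_op K)
  (K1 : forall x, nrm (K x) <= nrm x).
Local Notation C := R[i].

(** Iterates for the fixed point equation [Y = (K + Y^2) / 2], which says that
    [I - Y] is a square root of [I - K]. *)
Fixpoint root_op n : H -> H :=
  if n is m.+1 then (2^-1 : C) *: (K + (root_op m \o root_op m)) else 0.

(** The same iteration for the number 1. These numbers dominate the norms of
    the operators [root_op n], and their increments those of [root_op]; being
    bounded by 1, they force convergence. *)
Fixpoint root_maj n : R :=
  if n is m.+1 then (1 + root_maj m ^+ 2) / 2 else 0.

Let half_nrm (x : H) : nrm ((2^-1 : C) *: x) = nrm x / 2.
Proof.
rewrite nrmZ mulrC; congr (_ * _).
have := nrm_real (2^-1 : R); rewrite fmorphV/= rmorph_nat => ->.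
by rewrite ger0_norm ?invr_ge0.
Qed.

Let root_majP n : 0 <= root_maj n <= 1 /\ root_maj n <= root_maj n.+1.
Proof. by elim: n => [|n] /=; nra. Qed.

Let root_maj0 n : 0 <= root_maj n. Proof. by have [/andP[]] := root_majP n. Qed.
Let root_maj1 n : root_maj n <= 1. Proof. by have [/andP[]] := root_majP n. Qed.

Let root_op_lin n : linear (root_op n).
Proof.
elim: n => [|n IH] c x y /=; first by rewrite scaler0 addr0.
rewrite !fctE /= linK !IH !scalerDr !scalerA addrACA.
by congr (_ + _ + (_ + _)); rewrite mulrC.
Qed.

Let root_op_sym n : symmetric_op (root_op n).
Proof.
elim: n => [|n IH] x y /=; first by rewrite inner0l inner0r.
rewrite !fctE /= innerZl innerZr innerDl innerDr symK !IH.
by rewrite fmorphV/= rmorph_nat.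
Qed.

Let root_op_le n x : nrm (root_op n x) <= root_maj n * nrm x.
Proof.
elim: n x => [|n IH] x /=; first by rewrite nrm0 mul0r.
rewrite !fctE /= half_nrm.
have := nrmD (K x) (root_op n (root_op n x)).
have := K1 x; have := IH (root_op n x); have := IH x.
by have := root_maj0 n; have := nrm_ge0 x; nra.
Qed.

(** With [u] and [v] consecutive iterates, [v^2 - u^2 = v (v - u) + (v - u) u]
    is estimated term by term, without knowing that [u] and [v] commute. *)
Let root_op_step n x :
  nrm (root_op n.+1 x - root_op n x) <= (root_maj n.+1 - root_maj n) * nrm x.
Proof.
elim: n x => [|n IH] x.
  by have := root_op_le 1 x; rewrite /= !subr0.
set u := root_op n; set v := root_op n.+1.
have -> : root_op n.+2 x - v x =
    (2^-1 : C) *: (v (v x - u x) + (v (u x) - u (u x))).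
  rewrite [X in _ - X = _](_ : _ = (2^-1 : C) *: (K x + u (u x)))//.
  rewrite [X in X - _ = _](_ : _ = (2^-1 : C) *: (K x + v (v x)))//.
  rewrite -scalerBr opprD addrACA subrr add0r.
  by rewrite (linB (root_op_lin n.+1 : linear v)) addrA subrK.
rewrite half_nrm.
have := nrmD (v (v x - u x)) (v (u x) - u (u x)).
have h1 := root_op_le n.+1 (v x - u x); have h2 := IH x; have h3 := IH (u x).
have h4 := root_op_le n x; rewrite -/u -/v in h1 h2 h3 h4.
have [/andP[y0 y1] yS] := root_majP n.
have y'0 := root_maj0 n.+1; have x0 := nrm_ge0 x.
rewrite [X in _ -> _ <= (X - _) * _](_ : _ = (1 + root_maj n.+1 ^+ 2) / 2)//.
rewrite [X in _ -> _ <= (_ - X) * _](_ : _ = (1 + root_maj n ^+ 2) / 2)//.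
set a := root_maj n.+1 in h1 h2 h3 yS y'0 *.
set b := root_maj n in h2 h3 h4 y0 yS *.
have := ler_wpM2l y'0 h2.
have ab0 : 0 <= a - b by rewrite subr_ge0.
by have := ler_wpM2l ab0 h4; nra.
Qed.

Let root_op_dist n m x : (n <= m)%N ->
  nrm (root_op m x - root_op n x) <= (root_maj m - root_maj n) * nrm x.
Proof.
move=> /subnKC <-; elim: (m - n)%N => [|k IH].
  by rewrite addn0 !subrr nrm0 mul0r.
rewrite addnS; apply: le_trans (nrmBD _ (root_op (n + k) x) _) _.
by have := root_op_step (n + k) x; lra.
Qed.

Let root_maj_sup : has_sup (range root_maj).
Proof.
split; first by exists (root_maj 0), 0%N.
by exists 1 => _ [n _ <-]; exact: root_maj1.
Qed.

Let gap n := sup (range root_maj) - root_maj n.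

Let gap_ge n m : root_maj m - root_maj n <= gap n.
Proof. by rewrite lerD2r; apply: ub_le_sup; [case: root_maj_sup|exists m]. Qed.

Let gap0 n : 0 <= gap n.
Proof. by have := gap_ge n n; rewrite subrr. Qed.

Let gap_small (e : R) : 0 < e -> exists n, gap n < e.
Proof.
move=> e0; have [_ [n _ <-] ne] := sup_adherent e0 root_maj_sup.
by exists n; rewrite /gap; lra.
Qed.

Let root_lim_subproof x :
  exists l, forall n, nrm (root_op n x - l) <= gap n * nrm x.
Proof.
pose B e := [set root_op n x | n in [set n | gap n * nrm x <= e]].
have x0 := nrm_ge0 x.
have [e e0|d e _ _ de [n nd <-]|e _ _ e0 [n ne <-] [m me <-]|l lB] :=
    @small_sets_limit _ _ B.
- have x1 : 0 < nrm x + 1 by rewrite ltr_pwDr.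
  have [n ne] := gap_small (divr_gt0 e0 x1).
  exists (root_op n x), n => //=; move: ne; rewrite ltr_pdivlMr//.
  by have := gap0 n; nra.
- by exists n => //; exact: le_trans nd de.
- wlog nm : n m ne me / (n <= m)%N.
    move=> W; have [|mn] := leqP n m; first exact: W.
    by rewrite nrmB; apply: W => //; exact: ltnW.
  rewrite nrmB; apply: le_trans (root_op_dist _ nm) _; apply: le_trans ne.
  by rewrite ler_wpM2r// gap_ge.
exists l => n; apply/ler_addgt0Pr => e e0; apply: lB.
  by rewrite ltr_wpDl// mulr_ge0.
by exists n => //=; rewrite lerDl ltW.
Qed.

Let Y := projT1 (choice root_lim_subproof).
Let YP x n : nrm (root_op n x - Y x) <= gap n * nrm x.
Proof. exact: (projT2 (choice root_lim_subproof)). Qed.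

Let gap_eq0 (V : normedZmodType C) (v : V) (M : R) : 0 <= M ->
  (forall n, nrm v <= M * gap n) -> v = 0.
Proof.
move=> M0 vM; apply: (@nrm_small0 _ _ M) => e /gap_small[n ne].
by apply: le_trans (vM n) _; rewrite ler_wpM2l// ltW.
Qed.

Let linY : linear Y.
Proof.
move=> c x y; apply/subr0_eq.
apply: (@gap_eq0 _ _ (nrm (c *: x + y) + nrm c * nrm x + nrm y)) => [|n].
  by rewrite !addr_ge0 ?mulr_ge0// nrm_ge0.
have -> : Y (c *: x + y) - (c *: Y x + Y y) =
    - (root_op n (c *: x + y) - Y (c *: x + y)) +
    (c *: (root_op n x - Y x) + (root_op n y - Y y)).
  by apply: inner_inj => z; rewrite root_op_lin !innerE; ring.
apply: le_trans (nrmD _ _) _; rewrite nrmN.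
apply: le_trans (lerD (lexx _) (nrmD _ _)) _; rewrite nrmZ.
have := YP (c *: x + y) n; have := YP y n.
by have := ler_wpM2l (nrm_ge0 c) (YP x n); lra.
Qed.

Let symY : symmetric_op Y.
Proof.
move=> x y; apply/subr0_eq; apply: (@gap_eq0 _ _ (2 * nrm x * nrm y)) => [|n].
  by rewrite !mulr_ge0// nrm_ge0.
have -> : inner (Y x) y - inner x (Y y) =
    inner x (root_op n y - Y y) - inner (root_op n x - Y x) y.
  by rewrite !innerE root_op_sym; ring.
apply: le_trans (nrmD _ _) _; rewrite nrmN.
have := CauchySchwarz x (root_op n y - Y y).
have := CauchySchwarz (root_op n x - Y x) y.
have := ler_wpM2l (nrm_ge0 x) (YP y n).
by have := ler_wpM2r (nrm_ge0 y) (YP x n); lra.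
Qed.

Let Y_le x : nrm (Y x) <= nrm x.
Proof.
apply/ler_addgt0Pr => e e0.
have x1 : 0 < nrm x + 1 by rewrite ltr_pwDr// nrm_ge0.
have [n] := gap_small (divr_gt0 e0 x1); rewrite ltr_pdivlMr// => ne.
have := YP x n; have := root_op_le n x; have := nrmBD (Y x) (root_op n x) 0.
rewrite !subr0 nrmB; have := ler_wpM2r (nrm_ge0 x) (root_maj1 n).
by have := gap0 n; lra.
Qed.

Let Y_fix x : Y x = (2^-1 : C) *: (K x + Y (Y x)).
Proof.
apply/subr0_eq; apply: (@gap_eq0 _ _ (2 * nrm x)) => [|n].
  by rewrite !mulr_ge0// nrm_ge0.
set u := root_op n.
have -> : Y x - (2^-1 : C) *: (K x + Y (Y x)) =
    (2^-1 : C) *: (u (u x - Y x) + (u (Y x) - Y (Y x))) -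
    (root_op n.+1 x - Y x).
  rewrite [root_op n.+1 x](_ : _ = (2^-1 : C) *: (K x + u (u x)))//.
  rewrite (linB (root_op_lin n : linear u)).
  by apply: inner_inj => z; rewrite !innerE; ring.
apply: le_trans (nrmD _ _) _; rewrite nrmN half_nrm.
have h1 := nrmD (u (u x - Y x)) (u (Y x) - Y (Y x)).
have h2 := root_op_le n (u x - Y x); have h3 := YP (Y x) n.
have h4 := ler_wpM2r (nrm_ge0 (u x - Y x)) (root_maj1 n).
have h5 := ler_wpM2l (gap0 n) (Y_le x); have h6 := YP x n; have h7 := YP x n.+1.
have h8 : gap n.+1 <= gap n by have [_ yS] := root_majP n; rewrite /gap; lra.
have h9 := ler_wpM2r (nrm_ge0 x) h8.
by rewrite -/u in h2 h3 h6; lra.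
Qed.

Lemma contraction_root :
  exists B : H -> H, positive_op B /\ B \o B = idfun - K.
Proof.
have bY : bounded_linear Y.
  by apply/bounded_linearP; split=> //; exists 1 => x; rewrite mul1r.
have symB : symmetric_op (idfun - Y).
  by move=> x y; rewrite !fctE /= !innerE symY.
have KE x : K x = (2 : C) *: Y x - Y (Y x).
  by rewrite {1}(Y_fix x) scalerA mulfV ?pnatr_eq0// scale1r addrK.
exists (idfun - Y); split; last first.
  apply/funext => x; rewrite !fctE /= KE linB//.
  by apply: inner_inj => z; rewrite !innerE; ring.
split; first by apply: bounded_linearB => //; exact: bounded_linear_id.
move=> x; rewrite qformE// ler0c /qform !fctE /= innerBl raddfB /= -nrm_sqrE.
rewrite subr_ge0; apply: le_trans (_ : nrm (inner (Y x) x) <= _).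
  exact: Re_le_nrm.
apply: le_trans (CauchySchwarz _ _) _.
by rewrite expr2 ler_wpM2r ?nrm_ge0.
Qed.

End ContractionRoot.

Section SquareRoot.
Context (R : realType) (H : hilbertType R).
Local Notation C := R[i].

(** Cauchy-Schwarz for the form of [A], applied to [x] and [A x]. *)
Lemma positive_nrm_le_qform (A : H -> H) (M : R) x : positive_op A ->
  (forall y, nrm (A y) <= M * nrm y) -> nrm (A x) ^+ 2 <= M * qform A x.
Proof.
move=> pA AM; have [linA _] := pA.1; have sA := positive_sym pA.
have q0 := positive_qform _ pA.
have M0 : A x != 0 -> 0 <= M.
  rewrite -nrm_gt0 => Ax0; have := AM x; have := nrm_ge0 x.
  by nra.
have [Ax0|Ax0] := eqVneq (A x) 0.
  by rewrite /qform Ax0 inner0l nrm0 expr0n mulr0.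
have CS := form_CauchySchwarz x (A x) linA sA q0.
have qA : qform A (A x) <= M * nrm (A x) ^+ 2.
  apply: le_trans (Re_le_nrm _) _; apply: le_trans (CauchySchwarz _ _) _.
  by rewrite expr2 mulrA ler_wpM2r ?nrm_ge0.
have s0 : 0 < nrm (A x) ^+ 2 by rewrite exprn_gt0// nrm_gt0.
rewrite -(ler_pM2r s0); apply: le_trans (_ : _ <= qform A x * qform A (A x)) _.
  by move: CS; rewrite inner_nrm nrm_real ger0_norm ?sqr_ge0// expr2.
by rewrite [M * _]mulrC -mulrA ler_wpM2l.
Qed.

(** If [M] bounds the norm of [A], then [I - A / M] is a symmetric contraction,
    so [A / M] has a positive root. *)
Lemma positive_root (A : H -> H) : positive_op A ->
  exists B : H -> H, positive_op B /\ B \o B = A.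
Proof.
move=> pA; have [linA _] := pA.1; have sA := positive_sym pA.
have [N N0 AN] := bounded_ge0 pA.1; pose M := N + 1.
have M0 : 0 < M by rewrite ltr_pwDr.
have AM y : nrm (A y) <= M * nrm y.
  by apply: le_trans (AN y) _; rewrite ler_wpM2r ?nrm_ge0// lerDl.
pose t : C := (M^-1)%:C%C; pose K := idfun - t *: A.
have linK : linear K.
  by apply: (bounded_linearB (bounded_linear_id _) (bounded_linearZ t pA.1)).1.
have tJ : t^* = t by rewrite conj_Creal ?complex_real.
have sK : symmetric_op K.
  by move=> x y; rewrite /K !fctE !innerE sA /= tJ.
have K1 x : nrm (K x) <= nrm x.
  rewrite -le_nrm_sqr.
  have -> : nrm (K x) ^+ 2 =
      nrm x ^+ 2 - 2 * M^-1 * qform A x + M^-1 ^+ 2 * nrm (A x) ^+ 2.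
    apply: complexI; rewrite -inner_nrm /K !fctE !innerE tJ /=.
    rewrite -[inner x (A x)]sA.
    move: (inner_nrm x) (inner_nrm (A x)) (qformE x sA).
    move: (nrm x ^+ 2) (nrm (A x) ^+ 2) (qform A x) => a b q -> -> ->.
    by rewrite !(rmorphD, rmorphN, rmorphM)/= -/t; ring.
  have h1 := positive_nrm_le_qform x pA AM.
  have i0 : 0 < M^-1 by rewrite invr_gt0.
  have h2 : M^-1 ^+ 2 * nrm (A x) ^+ 2 <= M^-1 * qform A x.
    by rewrite expr2 -mulrA ler_pM2l// ler_pdivrMl.
  have h3 := mulr_ge0 (ltW i0) (positive_qform x pA).
  by rewrite -!mulrA; lra.
have [B [pB BB]] := contraction_root linK sK K1.
pose s : C := (Num.sqrt M)%:C%C.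
have ss : s * s * t = 1.
  by rewrite -!rmorphM -expr2 sqr_sqrtr ?(ltW M0)// mulfV ?gt_eqF// rmorph1.
exists (s *: B); split.
  split; first exact: bounded_linearZ pB.1.
  by move=> x; rewrite fctE innerZl mulr_ge0 ?ler0c ?sqrtr_ge0//; exact: pB.2.
apply/funext => x; have linB := pB.1.1.
have /(congr1 (@^~ x)) : B \o B = t *: A.
  by rewrite BB /K opprB addrC subrK.
by rewrite /= !fctE linZ// scalerA => ->; rewrite scalerA ss scale1r.
Qed.

Lemma sqrt_opP (A : H -> H) : positive_op A ->
  positive_op (sqrt_op A) /\ sqrt_op A \o sqrt_op A = A.
Proof.
move=> /positive_root[B pB]; rewrite /sqrt_op; case: xgetP => [D _ //|].
by move=> /(_ B) [].
Qed.

End SquareRoot.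

(** * Operators with dense range *)

Section DenseRange.
Context (R : realType).
Local Notation C := R[i].

Definition dense_range (H K : hilbertType R) (D : H -> K) :=
  forall y, closure (range D) y.

Lemma dense_rangeP (H K : hilbertType R) (D : H -> K) : dense_range D ->
  forall y (e : R), 0 < e -> exists x, nrm (y - D x) < e.
Proof.
move=> dD y e e0; have /closure_nrmP/(_ e e0)[_ [x _ <-] yx] := dD y.
by exists x.
Qed.

Lemma dense_inner0 (H K : hilbertType R) (D : H -> K) z : dense_range D ->
  (forall x, inner z (D x) = 0) -> z = 0.
Proof.
move=> dD zD; have [//|z0] := eqVneq z 0.
apply: (@nrm_small0 _ _ 1) => e e0; have [x zx] := dense_rangeP dD z e0.
rewrite mul1r; apply: ltW; rewrite -(@ltr_pM2r _ (nrm z)) ?nrm_gt0//.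
have -> : nrm z * nrm z = nrm (inner z (z - D x)).
  by rewrite innerBr zD subr0 inner_nrm nrm_real ger0_norm ?sqr_ge0// expr2.
apply: le_lt_trans (CauchySchwarz _ _) _.
by rewrite mulrC ltr_pM2r// nrm_gt0.
Qed.

Lemma dense_inner_inj (H K : hilbertType R) (D : H -> K) z w : dense_range D ->
  (forall x, inner z (D x) = inner w (D x)) -> z = w.
Proof.
move=> dD zw; apply/subr0_eq/(dense_inner0 dD) => x.
by rewrite innerBl zw subrr.
Qed.

Lemma dense_eq (H K L : hilbertType R) (D : H -> K) (A B : K -> L) :
  dense_range D -> bounded_linear A -> bounded_linear B ->
  (forall x, A (D x) = B (D x)) -> A = B.
Proof.
move=> dD bA bB AB; apply/funext => y; apply: inner_inj => z.
rewrite (adjP bA) (adjP bB) -[LHS]innerC -[RHS]innerC; congr (_^*).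
congr (inner _ _); apply: (dense_inner_inj dD) => x.
by rewrite (adjPr bA) (adjPr bB) AB.
Qed.

Lemma dense_range_comp (G H K : hilbertType R) (E : G -> H) (D : H -> K) :
  bounded_linear D -> dense_range D -> dense_range E -> dense_range (D \o E).
Proof.
move=> bD dD dE y; apply/closure_nrmP => e e0.
have [M M0 DM] := bounded_ge0 bD; have linD := bD.1.
have e2 : 0 < e / 2 by rewrite divr_gt0.
have [x yx] := dense_rangeP dD y e2.
have eM : 0 < e / (2 * (M + 1)) by rewrite divr_gt0// mulr_gt0// ltr_pwDr.
have [u xu] := dense_rangeP dE x eM; exists (D (E u)); first by exists u.
have := nrmBD y (D x) (D (E u)); rewrite -(linB linD) => h.
have := DM (x - E u).
have : M * nrm (x - E u) <= e / 2.
  apply: le_trans (ler_wpM2l M0 (ltW xu)) _.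
  rewrite mulrA ler_pdivrMr ?mulr_gt0 ?ltr_pwDr//.
  have -> : e / 2 * (2 * (M + 1)) = e * (M + 1) by field.
  by nra.
by lra.
Qed.

Lemma surjective_dense (H K : hilbertType R) (D : H -> K) (g : K -> H) :
  cancel g D -> dense_range D.
Proof. by move=> gK y; apply: subset_closure; exists (g y). Qed.

(** The operator is [V x |-> W x], which is isometric on the range of [V] and
    extends by density. *)
Lemma isometry_extension (H K L : hilbertType R) (V : H -> K) (W : H -> L) :
  linear V -> linear W -> (forall x, nrm (V x) = nrm (W x)) -> dense_range V ->
  exists U : K -> L,
    [/\ bounded_linear U, (forall y, nrm (U y) = nrm y) &
        forall x, U (V x) = W x].
Proof.
move=> linV linW VW dV.
have /choice[U UP] : forall y, exists l, forall x,
    nrm (W x - l) <= 2 * nrm (V x - y).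
  move=> y; pose B e := [set W x | x in [set x | nrm (V x - y) < e / 2]].
  have [e e0|d e _ _ de [x xd <-]|e _ _ e0 [x xe <-] [z ze <-]|l lB] :=
      @small_sets_limit _ _ B.
  - have e2 : 0 < e / 2 by rewrite divr_gt0.
    by have [x yx] := dense_rangeP dV y e2; exists (W x), x; rewrite //= nrmB.
  - by exists x => //=; move: xd => /=; lra.
  - rewrite -linB// -VW linB//; move: xe ze => /= xe ze.
    by have := nrmBD (V x) y (V z); rewrite (nrmB y); lra.
  exists l => x; apply/ler_addgt0Pr => e e0; apply: lB.
    by rewrite ltr_wpDl// mulr_ge0// nrm_ge0.
  by exists x => //=; lra.
have UV x : U (V x) = W x.
  by apply/subr0_eq/(@nrm_small0 _ _ 0) => e _; rewrite nrmB mul0r;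
    have := UP (V x) x; rewrite subrr nrm0 mulr0.
have nU y : nrm (U y) = nrm y.
  have near e : 0 < e -> `|nrm (U y) - nrm y| <= 0 + e.
    move=> e0; have e3 : 0 < e / 3 by rewrite divr_gt0.
    have [x yx] := dense_rangeP dV y e3.
    have h1 := UP y x; have h2 := VW x; rewrite nrmB in yx.
    have h3 := nrmBD (U y) (W x) 0; have h4 := nrmBD (W x) (U y) 0.
    have h5 := nrmBD y (V x) 0; have h6 := nrmBD (V x) y 0.
    rewrite !subr0 in h3 h4 h5 h6; rewrite (nrmB (U y)) in h3.
    by rewrite (nrmB y) in h5; rewrite ler_norml; lra.
  have /ler_addgt0Pr := near; rewrite normr_le0 subr_eq0.
  by move=> /eqP.
have linU : linear U.
  move=> c y z; apply/subr0_eq.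
  apply: (@nrm_small0 _ _ (4 * (nrm c + 1))) => e e0.
  have [x yx] := dense_rangeP dV y e0; have [w zw] := dense_rangeP dV z e0.
  have -> : U (c *: y + z) - (c *: U y + U z) =
      - (W (c *: x + w) - U (c *: y + z)) + (c *: (W x - U y) + (W w - U z)).
    by apply: inner_inj => t; rewrite linW !innerE; ring.
  apply: le_trans (nrmD _ _) _; rewrite nrmN.
  apply: le_trans (lerD (lexx _) (nrmD _ _)) _; rewrite nrmZ.
  have h1 := UP (c *: y + z) (c *: x + w); have h2 := UP y x; have h3 := UP z w.
  have h4 : nrm (V (c *: x + w) - (c *: y + z)) <=
      nrm c * nrm (V x - y) + nrm (V w - z).
    by rewrite linV opprD addrACA -scalerBr -nrmZ nrmD.
  rewrite nrmB in yx; rewrite nrmB in zw.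
  by have := nrm_ge0 c; nra.
exists U; split=> //; apply/bounded_linearP; split=> //.
by exists 1 => y; rewrite nU mul1r.
Qed.

(** The symmetric operator [adj U \o U - I] has zero quadratic form. *)
Lemma isometry_adj (H K : hilbertType R) (U : H -> K) : bounded_linear U ->
  (forall x, nrm (U x) = nrm x) -> adj U \o U = idfun.
Proof.
move=> bU nU; have bU' := adj_bounded bU.
pose E := (adj U \o U) - idfun.
have bE : bounded_linear E.
  apply: bounded_linearB; last exact: bounded_linear_id.
  exact: bounded_linear_comp.
have sE : symmetric_op E.
  by move=> x y; rewrite /E !fctE !innerE /= (adjPr bU) (adjP bU).
have qE x : qform E x = 0.
  rewrite /qform /E !fctE innerBl /= (adjPr bU) !inner_nrm nU.
  by rewrite subrr.
apply/subr0_eq/funext => x; apply: inner_eq0r => y; apply: nrm_eq0.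
apply/eqP; rewrite -sqrf_eq0 eq_le sqr_ge0 andbT.
have := form_CauchySchwarz x y bE.1 sE; rewrite !qE mulr0; apply.
by move=> z; rewrite qE.
Qed.

(** Two operators with the same norms and dense ranges differ by a unitary: the
    extensions of [V x |-> W x] and of [W x |-> V x] are inverse to each other.
    *)
Lemma unitary_extension (H K L : hilbertType R) (V : H -> K) (W : H -> L) :
  linear V -> linear W -> (forall x, nrm (V x) = nrm (W x)) ->
  dense_range V -> dense_range W ->
  exists U : K -> L, unitary U /\ forall x, U (V x) = W x.
Proof.
move=> linV linW VW dV dW.
have [U [bU nU UV]] := isometry_extension linV linW VW dV.
have [T [bT nT TW]] := isometry_extension linW linV (fun x => esym (VW x)) dW.
have UT : U \o T = idfun.
  apply: (dense_eq dW); [exact: bounded_linear_comp|exact: bounded_linear_id|].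
  by move=> x; rewrite /= TW UV.
have U'U := isometry_adj bU nU.
have adjU : adj U = T.
  apply/funext => y; have /(congr1 (@^~ y)) /= UTy := UT.
  by rewrite -{1}UTy; exact: (congr1 (@^~ (T y)) U'U).
by exists U; split=> //; split; rewrite // adjU.
Qed.

End DenseRange.

(** * Operator norm and spectral radius *)

Section OperatorNorm.
Context (R : realType).
Local Notation C := R[i].

Lemma opnorm_le (H K : hilbertType R) (A : H -> K) (c : R) : 0 <= c ->
  (forall x, nrm (A x) <= c * nrm x) -> opnorm A <= c.
Proof.
move=> c0 cA; apply: ge_sup.
  by exists (complex.Re `|A 0|), 0 => //=; rewrite normr0.
move=> _ [x /= x1 <-]; apply: le_trans (cA x) _.
by rewrite ler_piMr// -lecR -nrmE.
Qed.

Lemma le_opnorm (H K : hilbertType R) (A : H -> K) x : bounded_linear A ->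
  nrm (A x) <= opnorm A * nrm x.
Proof.
move=> bA; have linA := bA.1; have [M M0 AM] := bounded_ge0 bA.
have [->|x0] := eqVneq x 0; first by rewrite lin0// !nrm0 mulr0.
have n0 : 0 < nrm x by rewrite nrm_gt0.
pose t : C := ((nrm x)^-1)%:C%C.
have nt : nrm t = (nrm x)^-1 by rewrite nrm_real ger0_norm// invr_ge0 ltW.
rewrite -ler_pdivrMr// mulrC -nt -nrmZ -linZ//.
apply: ub_le_sup; last first.
  exists (t *: x) => //=; rewrite nrmE nrmZ nt mulVf ?gt_eqF//.
exists M => _ [y /= y1 <-]; apply: le_trans (AM y) _.
by rewrite ler_piMr// -lecR -nrmE.
Qed.

(** [spectral_radius] is a supremum in [R], so this requires the spectrum to
    be bounded: [A - w I] is coercive once the modulus of [w] exceeds a bound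
    of [A]. *)
Lemma le_spectral_radius (H : hilbertType R) (A : H -> H) (z : C) :
  bounded_linear A -> spectrum A z -> nrm z <= spectral_radius A.
Proof.
move=> bA Az; apply: ub_le_sup; last by exists z.
have [M M0 AM] := bounded_ge0 bA; exists M => _ [w /= Aw <-].
rewrite leNgt; apply/negP => Mw; apply: Aw.
have Mw0 : 0 < nrm w - M by rewrite subr_gt0.
apply: (coercive_invertible _ Mw0).
  by apply: bounded_linearB => //; apply/bounded_linearZ/bounded_linear_id.
move=> x; rewrite !fctE innerBl innerZl /= inner_nrm.
have := nrmBD (w * (nrm x ^+ 2)%:C%C) (inner (A x) x) 0.
rewrite !subr0 nrmM nrm_real ger0_norm ?sqr_ge0// nrmB.
have := CauchySchwarz (A x) x; have := AM x; have := nrm_ge0 x.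
by rewrite mulrBl expr2 => h1 h2 h3; have := ler_wpM2r h1 h2; lra.
Qed.

End OperatorNorm.

(** * Polynomials in a Gamma_3-contraction *)

Section AffineCalculus.
Context (R : realType) (H : hilbertType R) (T : 'I_3 -> H -> H).
Local Notation C := R[i].

Let mono (m : multinom 3) : H -> H :=
  \big[(fun A B : H -> H => A \o B)/idfun]_(i < 3) iter (m i) (T i).

(** Polynomials with different supports are compared by summing over a common
    set of monomials. *)
Lemma mpoly_op_support (p : mpoly 3 C) (s : seq (multinom 3)) :
  uniq s -> {subset msupp p <= s} ->
  mpoly_op T p = \sum_(m <- s) mcoeff m p *: mono m.
Proof.
move=> us ps; rewrite (bigID (mem (msupp p))) /=.
rewrite [X in _ = _ + X]big1 ?addr0 => [|m]; last first.
  by move/memN_msupp_eq0 => ->; rewrite scale0r.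
rewrite -big_filter /mpoly_op; apply: perm_big.
apply: uniq_perm; [exact: msupp_uniq|exact: filter_uniq|move=> m].
by rewrite mem_filter; case: (boolP (m \in msupp p)) => // /ps ->.
Qed.

Lemma mpoly_op_linear (c : C) (p q : mpoly 3 C) :
  mpoly_op T (c *: p + q) = c *: mpoly_op T p + mpoly_op T q.
Proof.
pose s := undup (msupp p ++ msupp q).
have us : uniq s by exact: undup_uniq.
have ps : {subset msupp p <= s} by move=> m pm; rewrite mem_undup mem_cat pm.
have qs : {subset msupp q <= s}.
  by move=> m qm; rewrite mem_undup mem_cat qm orbT.
have pqs : {subset msupp (c *: p + q) <= s}.
  move=> m /msuppD_le; rewrite mem_cat => /orP[/msuppZ_le|]; first exact: ps.
  exact: qs.
rewrite !(@mpoly_op_support _ s)// scaler_sumr -big_split /=.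
by apply: eq_bigr => m _; rewrite mcoeffD mcoeffZ scalerDl scalerA.
Qed.

Lemma mpoly_op_mono m : mpoly_op T (mpolyX C m) = mono m.
Proof. by rewrite /mpoly_op msuppX big_seq1 mcoeffX eqxx scale1r. Qed.

Lemma mpoly_op_one : mpoly_op T (mpolyX C (@mnm0 3)) = idfun.
Proof. by rewrite mpoly_op_mono /mono !big_ord_recl big_ord0 !mnmE. Qed.

Lemma mpoly_op_var i : mpoly_op T (mpolyX C (mnm1 i)) = T i.
Proof.
rewrite mpoly_op_mono /mono !big_ord_recl big_ord0 !mnm1E.
case: i => -[|[|[|//]]] lt3; apply/funext => x /=.
- by congr (T _ x); apply: val_inj.
- by congr (T _ x); apply: val_inj.
- by congr (T _ x); apply: val_inj.
Qed.

End AffineCalculus.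

Section Tridisc.
Context (R : realType).
Local Notation C := R[i].

Definition affine_poly (c0 c1 c2 c3 : C) : mpoly 3 C :=
  c0 *: mpolyX C (@mnm0 3) + (c1 *: mpolyX C (mnm1 0) +
    (c2 *: mpolyX C (mnm1 1) + c3 *: mpolyX C (mnm1 2))).

Lemma mpoly_op_affine (H : hilbertType R) (S1 S2 P : H -> H) c0 c1 c2 c3 :
  mpoly_op (tnth [tuple S1; S2; P]) (affine_poly c0 c1 c2 c3) =
  c0 *: idfun + (c1 *: S1 + (c2 *: S2 + c3 *: P)).
Proof.
rewrite /affine_poly -[c3 *: mpolyX _ _]addr0 !mpoly_op_linear !mpoly_op_var.
by rewrite mpoly_op_one /mpoly_op msupp0 big_nil addr0.
Qed.

Lemma meval_affine (z1 z2 z3 c0 c1 c2 c3 : C) :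
  meval (pi3 z1 z2 z3) (affine_poly c0 c1 c2 c3) =
  c0 + c1 * (z1 + z2 + z3) + c2 * (z1 * z2 + z1 * z3 + z2 * z3) +
  c3 * (z1 * z2 * z3).
Proof.
rewrite /affine_poly !mevalD !mevalZ !mevalXU mevalX big1 => [|i _]; last first.
  by rewrite mnmE expr0.
by rewrite mulr1 !addrA.
Qed.

(** The difference of the squared moduli is the product of [1 - |a|^2] and
    [1 - |z|^2]. *)
Lemma Moebius_bound (a z : C) : `|a| < 1 -> `|z| <= 1 ->
  1 - a^* * z != 0 /\ `|z - a| <= `|1 - a^* * z|.
Proof.
move=> a1 z1; split.
  rewrite subr_eq0; apply/eqP => az.
  have : `|a^* * z| < 1.
    rewrite normrM norm_conjC; apply: le_lt_trans a1.
    by rewrite ler_piMr.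
  by rewrite -az normr1 ltxx.
rewrite -(@ler_pXn2r _ 2)// ?nnegrE// !normCK -subr_ge0.
rewrite !(rmorphB, rmorphM, rmorph1)/= conjCK.
have -> : (1 - a^* * z) * (1 - a * z^*) - (z - a) * (z^* - a^*) =
  (1 - a * a^*) * (1 - z * z^*) by ring.
by rewrite -!normCK mulr_ge0// subr_ge0 expr_le1// ltW.
Qed.

Definition tau_num (H : hilbertType R) (a : C) (S1 S2 P : H -> H) : H -> H :=
  P - a *: S2 + a ^+ 2 *: S1 - a ^+ 3 *: idfun.

(** The two operators are the values at the triple of the polynomials that take
    at [pi3 z1 z2 z3] the values [prod (z_i - a)] and [prod (1 - a^* z_i)]; on
    Gamma_3 the second has no zero and dominates the first. *)
Lemma Gamma3_vonNeumann (H : hilbertType R) (S1 S2 P : H -> H) (a : C) :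
  Gamma3_contraction S1 S2 P -> `|a| < 1 ->
  invertible (tau_denom a S1 S2 P) /\
  forall x, nrm (tau_num a S1 S2 P x) <= nrm (tau_denom a S1 S2 P x).
Proof.
move=> [bS cS _ vN] a1.
pose q := affine_poly 1 (- a^*) (a^* ^+ 2) (- a^* ^+ 3).
pose p := affine_poly (- a ^+ 3) (a ^+ 2) (- a) 1.
have qE z1 z2 z3 : meval (pi3 z1 z2 z3) q =
    (1 - a^* * z1) * (1 - a^* * z2) * (1 - a^* * z3).
  by rewrite meval_affine; ring.
have pE z1 z2 z3 : meval (pi3 z1 z2 z3) p = (z1 - a) * (z2 - a) * (z3 - a).
  by rewrite meval_affine; ring.
have q0 w : Gamma3 w -> meval w q != 0.
  move=> [z1 [z2 [z3 [h1 h2 h3 ->]]]]; rewrite qE !mulf_neq0//.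
  - exact: (Moebius_bound a1 h1).1.
  - exact: (Moebius_bound a1 h2).1.
  - exact: (Moebius_bound a1 h3).1.
have [iq nq] := vN p q q0.
have qop : mpoly_op (tnth [tuple S1; S2; P]) q = tau_denom a S1 S2 P.
  by rewrite mpoly_op_affine /tau_denom scale1r !scaleNr !addrA.
have pop x : mpoly_op (tnth [tuple S1; S2; P]) p x = tau_num a S1 S2 P x.
  rewrite mpoly_op_affine /tau_num !fctE /= scale1r.
  by apply: inner_inj => z; rewrite !innerE; ring.
rewrite qop in iq nq; split=> // x; rewrite -pop.
have bp : bounded_linear (mpoly_op (tnth [tuple S1; S2; P]) p).
  have b1 : bounded_linear S1 by exact: (bS 0).
  have b2 : bounded_linear S2 by exact: (bS 1).
  have b3 : bounded_linear P by exact: (bS 2).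
  rewrite mpoly_op_affine.
  do ?[apply: bounded_linearD|apply: bounded_linearZ] => //.
  exact: bounded_linear_id.
have le1 : opnorm (mpoly_op (tnth [tuple S1; S2; P]) p \o
    inv_op (tau_denom a S1 S2 P)) <= 1.
  apply: le_trans nq _; apply: ge_sup.
    exists (complex.Re `|meval (pi3 0 0 0) p / meval (pi3 0 0 0) q|).
    by exists (pi3 0 0 0) => //; exists 0, 0, 0; rewrite normr0 ler01.
  move=> _ [_ [z1 [z2 [z3 [h1 h2 h3 ->]]]] <-].
  rewrite -[leLHS]/(nrm _) -lecR -nrmE qE pE !normrM normfV !normrM.
  have [n1 l1] := Moebius_bound a1 h1; have [n2 l2] := Moebius_bound a1 h2.
  have [n3 l3] := Moebius_bound a1 h3.
  rewrite ler_pdivrMr ?mul1r ?mulr_gt0 ?normr_gt0//.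
  by rewrite !ler_pM ?mulr_ge0.
have := le_opnorm (tau_denom a S1 S2 P x)
  (bounded_linear_comp bp (inv_op_bounded iq)).
rewrite /= inv_opK// => le2; apply: le_trans le2 _.
by rewrite ler_piMl ?nrm_ge0.
Qed.

(** The case [a = 0] of the previous inequality. *)
Lemma Gamma3_P_contraction (H : hilbertType R) (S1 S2 P : H -> H) :
  Gamma3_contraction S1 S2 P -> forall x, nrm (P x) <= nrm x.
Proof.
move=> /(@Gamma3_vonNeumann _ _ _ _ 0); rewrite normr0 => /(_ ltr01)[_ PN] x.
have := PN x; rewrite /tau_num /tau_denom !fctE conjC0 !expr0n /= !scale0r.
by rewrite !subr0 !addr0.
Qed.

End Tridisc.

(** * Algebra of the fundamental equations *)

Section Core.
Context (R : realType) (H K : hilbertType R).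
Local Notation C := R[i].

(** The weak form of [S - adj S' P = D_P A D_P], for [D_P] regarded as an
    operator [D] from [H] to the defect space. *)
Definition fundamental_eq (D : H -> K) (A : K -> K) (S S' P : H -> H) :=
  forall x y, inner (A (D x)) (D y) = inner (S x) y - inner (P x) (S' y).

Lemma fundamental_eq_unique (D : H -> K) (A B : K -> K) (S S' P : H -> H) :
  dense_range D -> bounded_linear A -> bounded_linear B ->
  fundamental_eq D A S S' P -> fundamental_eq D B S S' P -> A = B.
Proof.
move=> dD bA bB AD BD; apply: (dense_eq dD) => // x.
by apply: (dense_inner_inj dD) => y; rewrite AD BD.
Qed.

Lemma fundamental_eqC D A S S' P : fundamental_eq D A S S' P ->
  forall x y, inner (D x) (A (D y)) = inner x (S y) - inner (S' x) (P y).
Proof.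
by move=> AD x y; rewrite -innerC AD rmorphB /= !innerC.
Qed.

Definition tau1_num (a : C) (S1 S2 P : H -> H) : H -> H :=
  (1 + 2 * `|a| ^+ 2) *: S1 - (a^* * (2 + `|a| ^+ 2)) *: S2
  + (3 * a^* ^+ 2) *: P - (3 * a) *: idfun.

Definition tau2_num (a : C) (S1 S2 P : H -> H) : H -> H :=
  (- a * (2 + `|a| ^+ 2)) *: S1 + (1 + 2 * `|a| ^+ 2) *: S2
  - (3 * a^*) *: P + (3 * a ^+ 2) *: idfun.

Definition pairX (a : C) (A1 : K -> K) : K -> K :=
  (1 + `|a| ^+ 2) *: idfun - a^* *: A1.

Definition pairY (a : C) (A2 : K -> K) : K -> K := a *: idfun - a^* *: A2.

Definition pairQ (A1 A2 : K -> K) : K -> K := (adj A1 \o A1) - (adj A2 \o A2).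

Definition pairT (a : C) (A1 A2 : K -> K) : K -> K :=
  (1 + `|a| ^+ 2 + `|a| ^+ 4) *: idfun
  - (1 + `|a| ^+ 2) *: (a *: adj A1 + a^* *: A1)
  + (a ^+ 2 *: adj A2 + a^* ^+ 2 *: A2)
  + `|a| ^+ 2 *: pairQ A1 A2.

(** [pairG1] and [pairG2] are the middle factors of the new fundamental pair,
    without the powers of [b]. *)
Definition pairG1 (a : C) (A1 A2 : K -> K) : K -> K :=
  (1 + 3 * `|a| ^+ 2) *: A1 + (a ^+ 2 * (3 + `|a| ^+ 2)) *: adj A1
  - (2 * a^*) *: A2 - (2 * a ^+ 3) *: adj A2
  - (a * (1 + `|a| ^+ 2)) *: pairQ A1 A2
  - (3 * a * (1 + `|a| ^+ 2)) *: idfun.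

Definition pairG2 (a : C) (A1 A2 : K -> K) : K -> K :=
  - (2 *: (a *: A1 + a ^+ 3 *: adj A1)) + A2 + a ^+ 4 *: adj A2
  + a ^+ 2 *: pairQ A1 A2 + (3 * a ^+ 2) *: idfun.

Context (S1 S2 P : H -> H) (D : H -> K) (A1 A2 : K -> K).
Hypotheses (bA1 : bounded_linear A1) (bA2 : bounded_linear A2).

(** This is the identity [T = adj X X - adj Y Y]. *)
Lemma pairT_form a x y : inner (pairT a A1 A2 x) y =
  inner (pairX a A1 x) (pairX a A1 y) - inner (pairY a A2 x) (pairY a A2 y).
Proof.
rewrite /pairT /pairQ /pairX /pairY !fctE /= !innerE.
rewrite !(adjPr bA1) !(adjPr bA2) (_ : 4 = 2 + 2)%N// exprD normCK.
rewrite !(rmorphD, rmorphM) /= !conjCK rmorph1.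
by ring.
Qed.

Lemma pairT_bounded a : bounded_linear (pairT a A1 A2).
Proof.
have b1 := adj_bounded bA1; have b2 := adj_bounded bA2.
have bQ : bounded_linear (pairQ A1 A2).
  by apply: bounded_linearB; exact: bounded_linear_comp.
rewrite /pairT; do ?[assumption|apply: bounded_linearD|apply: bounded_linearN
  |apply: bounded_linearZ|exact: bounded_linear_id].
Qed.

Hypotheses (dD : dense_range D)
  (c12 : forall x, S1 (S2 x) = S2 (S1 x))
  (c1P : forall x, S1 (P x) = P (S1 x)) (c2P : forall x, S2 (P x) = P (S2 x))
  (cA : forall x, A1 (A2 x) = A2 (A1 x))
  (DD : forall x y, inner (D x) (D y) = inner x y - inner (P x) (P y))
  (AD1 : fundamental_eq D A1 S1 S2 P) (AD2 : fundamental_eq D A2 S2 S1 P).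

(** Tested against the dense range of [D], both sides become
    [inner (S1 x) y - inner (P (S1 x)) (P y)]. *)
Lemma intertwine1 x : D (S1 x) = A1 (D x) + adj A2 (D (P x)).
Proof.
apply: (dense_inner_inj dD) => y.
rewrite DD innerDl AD1 (adjPr bA2) (fundamental_eqC AD2) c1P.
by ring.
Qed.

Lemma intertwine2 x : D (S2 x) = A2 (D x) + adj A1 (D (P x)).
Proof.
apply: (dense_inner_inj dD) => y.
rewrite DD innerDl AD2 (adjPr bA1) (fundamental_eqC AD1) c2P.
by ring.
Qed.

(** The identity [S1^* S1 - S2^* S2 = D^* (A1^* A1 - A2^* A2) D]. Intertwining
    produces the extra terms [A2 A1] and [A1 A2], which cancel because the pair
    commutes. *)
Lemma pairQ_form x y :
  inner (A1 (D x)) (A1 (D y)) - inner (A2 (D x)) (A2 (D y)) =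
  inner (S1 x) (S1 y) - inner (S2 x) (S2 y).
Proof.
have e1 : A1 (D x) = D (S1 x) - adj A2 (D (P x)) by rewrite intertwine1 addrK.
have e2 : A2 (D x) = D (S2 x) - adj A1 (D (P x)) by rewrite intertwine2 addrK.
rewrite {1}e1 {1}e2 !innerBl (adjPr bA1) (adjPr bA2) cA.
rewrite (fundamental_eqC AD1) (fundamental_eqC AD2) c12.
by ring.
Qed.

Let pairQ_form' x y : inner (A1 (D x)) (A1 (D y)) =
  inner (A2 (D x)) (A2 (D y)) + (inner (S1 x) (S1 y) - inner (S2 x) (S2 y)).
Proof. by rewrite -pairQ_form; ring. Qed.

(** In [N^* N - M^* M], with [N] the common denominator of [tau] and [M] the
    numerator of its last entry, the terms [S1^* S2] and [S2^* S1] cancel and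
    the others group into [S1 - S2^* P], [S2 - S1^* P], their adjoints,
    [I - P^* P] and [S1^* S1 - S2^* S2], all of which factor through [D]. *)
Lemma pairT_transfer a x y :
  (1 - `|a| ^+ 2) * inner (pairT a A1 A2 (D x)) (D y) =
  inner (tau_denom a S1 S2 P x) (tau_denom a S1 S2 P y) -
  inner (tau_num a S1 S2 P x) (tau_num a S1 S2 P y).
Proof.
rewrite /pairT /pairQ /tau_denom /tau_num !fctE /= !innerE.
rewrite !(adjPr bA1) !(adjPr bA2) pairQ_form' DD AD1 AD2.
rewrite !(fundamental_eqC AD1) !(fundamental_eqC AD2).
rewrite (_ : 4 = 2 + 2)%N// exprD normCK !rmorphXn /= !conjCK.
by ring.
Qed.

(** With [L_1] and [L_2] the numerators of the first two entries of [tau],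
    [N^* L_1 - L_2^* M] regroups in the same way as [N^* N - M^* M]; conjugated
    by the inverse of [N] it is the left-hand side of the first fundamental
    equation of the image, up to the factor [b]. *)
Lemma pairG1_transfer a x y :
  (1 - `|a| ^+ 2) * inner (pairG1 a A1 A2 (D x)) (D y) =
  inner (tau1_num a S1 S2 P x) (tau_denom a S1 S2 P y) -
  inner (tau_num a S1 S2 P x) (tau2_num a S1 S2 P y).
Proof.
rewrite /pairG1 /pairQ /tau1_num /tau2_num /tau_denom /tau_num !fctE /= !innerE.
rewrite !(adjPr bA1) !(adjPr bA2) pairQ_form' DD AD1 AD2.
rewrite !(fundamental_eqC AD1) !(fundamental_eqC AD2) normCK.
rewrite !(rmorphD, rmorphN, rmorphM, rmorphXn, rmorph1) /= !conjCK.
by ring.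
Qed.

Lemma pairG2_transfer a x y :
  (1 - `|a| ^+ 2) * inner (pairG2 a A1 A2 (D x)) (D y) =
  inner (tau2_num a S1 S2 P x) (tau_denom a S1 S2 P y) -
  inner (tau_num a S1 S2 P x) (tau1_num a S1 S2 P y).
Proof.
rewrite /pairG2 /pairQ /tau1_num /tau2_num /tau_denom /tau_num !fctE /= !innerE.
rewrite !(adjPr bA1) !(adjPr bA2) pairQ_form' DD AD1 AD2.
rewrite !(fundamental_eqC AD1) !(fundamental_eqC AD2) normCK.
rewrite !(rmorphD, rmorphN, rmorphM, rmorphXn, rmorph1) /= !conjCK.
by ring.
Qed.

End Core.

(** * The defect operator *)

Section Defect.
Context (R : realType) (H : hilbertType R) (P : H -> H).
Local Notation C := R[i].
Hypotheses (bP : bounded_linear P) (P1 : forall x, nrm (P x) <= nrm x).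

Lemma defect_positive : positive_op (idfun - (adj P \o P)).
Proof.
split.
  apply: bounded_linearB; first exact: bounded_linear_id.
  by apply: bounded_linear_comp => //; exact: adj_bounded.
move=> x; rewrite !fctE /= innerBl (adjPr bP) !inner_nrm subr_ge0 lecR.
by rewrite le_nrm_sqr.
Qed.

Lemma defect_opP :
  positive_op (defect_op P) /\
  defect_op P \o defect_op P = idfun - (adj P \o P).
Proof. exact: sqrt_opP defect_positive. Qed.

Let D := defect_corestr P.
Let posD := defect_opP.1.

Lemma defect_corestr_bounded : bounded_linear D.
Proof.
have /bounded_linearP[linD [M DM]] := posD.1.
apply/bounded_linearP; split.
  by move=> c x y; apply: val_inj; exact: linD.
by exists M => x; exact: DM.
Qed.

Lemma defect_corestr_dense : dense_range D.
Proof.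
move=> y; apply/closure_nrmP => e e0.
have : closure (range (defect_op P)) (val y) by exact: (set_mem (valP y)).
move=> /closure_nrmP/(_ e e0)[_ [x _ <-] yx].
by exists (D x); first by exists x.
Qed.

Lemma inner_defect_corestr x (z : defect_space P) :
  inner (D x) z = inner x (defect_op P (val z)).
Proof. exact: (positive_sym posD x (val z)). Qed.

Lemma defect_corestr_form x y :
  inner (D x) (D y) = inner x y - inner (P x) (P y).
Proof.
rewrite inner_defect_corestr /=.
have /(congr1 (@^~ y)) /= -> := defect_opP.2.
by rewrite !fctE /= innerBr (adjP bP).
Qed.

(** Compressing by [D_P] on both sides is [A |-> D^* A D] for the corestriction
    [D], whose adjoint is the restriction of [D_P] to the defect space. *)
Lemma fundamental_pairP (S1 S2 : H -> H)
    (A1 A2 : defect_space P -> defect_space P) :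
  bounded_linear S1 -> bounded_linear S2 ->
  fundamental_pair S1 S2 P A1 A2 <->
  [/\ bounded_linear A1, bounded_linear A2,
      fundamental_eq D A1 S1 S2 P & fundamental_eq D A2 S2 S1 P].
Proof.
move=> b1 b2.
have sandwich A S S' : bounded_linear S' ->
    S - (adj S' \o P) = defect_sandwich A <-> fundamental_eq D A S S' P.
  move=> b'; split=> [E x y|E].
    rewrite -innerC inner_defect_corestr innerC.
    have /(congr1 (@^~ x)) := E; rewrite /defect_sandwich /= => <-.
    by rewrite !fctE /= innerBl (adjPr b').
  apply/funext => x; apply: inner_inj => y.
  rewrite !fctE /= innerBl (adjPr b') -E -[LHS]innerC inner_defect_corestr.
  by rewrite innerC.
by split=> -[bA1 bA2 /sandwich E1 /sandwich E2]; split=> //;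
  [exact: E1|exact: E2|exact: E1|exact: E2].
Qed.

End Defect.

(** * The operators X, Y and T of a pair *)

Section OperatorComplements.
Context (R : realType).
Local Notation C := R[i].

Lemma dense_nrm_le (H K L : hilbertType R) (D : H -> K) (A B : K -> L) :
  dense_range D -> bounded_linear A -> bounded_linear B ->
  (forall x, nrm (B (D x)) <= nrm (A (D x))) ->
  forall z, nrm (B z) <= nrm (A z).
Proof.
move=> dD bA bB BA z; apply/ler_addgt0Pr => e e0.
have [M M0 AM] := bounded_ge0 bA; have [N N0 BN] := bounded_ge0 bB.
have S0 : 0 < M + N + 1 by rewrite ltr_wpDl// addr_ge0.
have [x zx] := dense_rangeP dD z (divr_gt0 e0 S0).
have h1 := AM (z - D x); have h2 := BN (z - D x).
rewrite (linB bA.1) in h1; rewrite (linB bB.1) in h2.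
have h3 := nrmBD (B z) (B (D x)) 0; have h4 := nrmBD (A (D x)) (A z) 0.
rewrite !subr0 (nrmB (A (D x))) in h4; rewrite !subr0 in h3.
have h5 : (M + N + 1) * nrm (z - D x) <= e.
  by move: zx; rewrite ltr_pdivlMr// mulrC => /ltW.
by have := BA x; have := nrm_ge0 (z - D x); lra.
Qed.

Lemma invertibleZ (H K : hilbertType R) (c : C) (A : H -> K) : c != 0 ->
  linear A -> invertible A -> invertible (c *: A).
Proof.
move=> c0 linA [B [bB BA AB]]; exists (c^-1 *: B); split.
- exact: bounded_linearZ.
- apply/funext => x; rewrite !fctE /= (linZ bB.1) scalerA mulVf// scale1r.
  exact: (congr1 (@^~ x) BA).
- apply/funext => x; rewrite !fctE /= linZ// scalerA mulfV// scale1r.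
  exact: (congr1 (@^~ x) AB).
Qed.

Lemma inv_op_positive (H : hilbertType R) (A : H -> H) :
  positive_op A -> invertible A -> positive_op (inv_op A).
Proof.
move=> pA iA; split; first exact: inv_op_bounded.
by move=> x; rewrite -{2}(inv_opVK iA x) -(positive_sym pA); exact: pA.2.
Qed.

End OperatorComplements.

Section PairTransforms.
Context (R : realType) (K : hilbertType R) (A1 A2 : K -> K).
Local Notation C := R[i].
Hypotheses (bA1 : bounded_linear A1) (bA2 : bounded_linear A2).

Lemma pairX_bounded a : bounded_linear (pairX a A1).
Proof.
apply: bounded_linearB; apply: bounded_linearZ => //.
exact: bounded_linear_id.
Qed.

Lemma pairY_bounded a : bounded_linear (pairY a A2).
Proof.
apply: bounded_linearB; apply: bounded_linearZ => //.
exact: bounded_linear_id.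
Qed.

Let nrm_lt1 (a : C) : (`|a| < 1) = (nrm a < 1).
Proof. by rewrite nrmE -ltcR. Qed.

Let nrm_le1 (a : C) : (`|a| <= 1) = (nrm a <= 1).
Proof. by rewrite nrmE -lecR. Qed.

(** For [a] on the unit circle the inequality is the limit of those for
    [(1 - t) a] as [t] tends to 0. *)
Lemma pairYX_le_closed :
  (forall a : C, `|a| < 1 ->
     forall z, nrm (pairY a A2 z) <= nrm (pairX a A1 z)) ->
  forall a : C, `|a| <= 1 ->
    forall z, nrm (pairY a A2 z) <= nrm (pairX a A1 z).
Proof.
move=> YX a a1 z; rewrite nrm_le1 in a1.
have a0 := nrm_ge0 a; have z0 := nrm_ge0 z.
have A1z := nrm_ge0 (A1 z); have A2z := nrm_ge0 (A2 z).
apply/ler_addgt0Pr => e e0.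
(* s exceeds the sum of the speeds of X z and Y z as a moves to (1 - t) a. *)
pose s := 3 * nrm z + nrm (A1 z) + nrm (A2 z) + 1.
have s0 : 0 < s by rewrite /s; lra.
pose t := Num.min 1 (e / s).
have t0 : 0 < t by rewrite lt_min ltr01 divr_gt0.
have t1 : t <= 1 by rewrite ge_min lexx.
have ts : t * s <= e by rewrite -ler_pdivlMr// ge_min lexx orbT.
pose r : C := (1 - t)%:C%C.
have rJ : r^* = r by rewrite conj_Creal ?complex_real.
have nr : nrm r = 1 - t by rewrite nrm_real ger0_norm// subr_ge0.
have ra : `|r * a| < 1 by rewrite nrm_lt1 nrmM nr; nra.
have tE : nrm (t%:C%C : C) = t by rewrite nrm_real ger0_norm// ltW.
have rE : r = 1 - t%:C%C by rewrite /r rmorphB rmorph1.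
have dY : pairY a A2 z - pairY (r * a) A2 z = t%:C%C *: (a *: z - a^* *: A2 z).
  apply: inner_inj => w; rewrite /pairY !fctE /= !innerE rmorphM/= rJ rE.
  by ring.
have dX : pairX (r * a) A1 z - pairX a A1 z =
    t%:C%C *: (a^* *: A1 z - ((2 - t)%:C%C * (a * a^*)) *: z).
  apply: inner_inj => w; rewrite /pairX !fctE /= !innerE !normCK.
  rewrite !rmorphM/= rJ rE.
  by rewrite rmorphB rmorph_nat; ring.
have := YX _ ra z.
have h1 := nrmBD (pairY a A2 z) (pairY (r * a) A2 z) 0.
have h2 := nrmBD (pairX (r * a) A1 z) (pairX a A1 z) 0.
rewrite !subr0 dY dX !nrmZ tE in h1 h2.
have h3 := nrmD (a *: z) (- (a^* *: A2 z)).
have h4 := nrmD (a^* *: A1 z) (- (((2 - t)%:C%C * (a * a^*)) *: z)).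
rewrite !nrmN !nrmZ !nrmM nrm_conj nrm_real ger0_norm in h3 h4; last by lra.
have h5 : nrm (a *: z - a^* *: A2 z) <= nrm z + nrm (A2 z) by nra.
have h6 : nrm (a^* *: A1 z - ((2 - t)%:C%C * (a * a^*)) *: z) <=
    nrm (A1 z) + 2 * nrm z.
  have : (2 - t) * (nrm a * nrm a) <= 2 by nra.
  by nra.
have := ler_wpM2l (ltW t0) h5; have := ler_wpM2l (ltW t0) h6.
by move: ts; rewrite /s; lra.
Qed.

(** Up to a factor, [X] is [A1 - w I] with [w = (1 + |a|^2) / a^*], and
    [|w| > 2] since [|a| < 1]. *)
Lemma pairX_invertible (a : C) : spectral_radius A1 <= 2 -> `|a| < 1 ->
  invertible (pairX a A1).
Proof.
rewrite nrm_lt1 => r2 a1; have [->|a0] := eqVneq a 0.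
  rewrite /pairX conjC0 scale0r subr0 normr0 expr0n addr0 scale1r.
  by exists idfun; split=> //; exact: bounded_linear_id.
have n0 : 0 < nrm a by rewrite nrm_gt0.
have aJ0 : a^* != 0 by rewrite conjC_eq0.
pose w := (1 + `|a| ^+ 2) / a^*.
have -> : pairX a A1 = - a^* *: (A1 - w *: idfun).
  rewrite scalerBr scalerA mulNr mulrC /w divfK// !scaleNr opprK addrC.
  by rewrite /pairX.
apply: invertibleZ; first by rewrite oppr_eq0.
  by apply: (bounded_linearB bA1 (bounded_linearZ w (bounded_linear_id _))).1.
apply: contrapT => /(le_spectral_radius bA1) wr.
have := le_trans wr r2; rewrite /w nrmM.
have -> : nrm (1 + `|a| ^+ 2 : C) = 1 + nrm a ^+ 2.
  have -> : 1 + `|a| ^+ 2 = (1 + nrm a ^+ 2)%:C%C :> C.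
    by rewrite nrmE rmorphD rmorph1 rmorphXn.
  rewrite nrm_real ger0_norm//.
  by rewrite addr_ge0 ?sqr_ge0.
have -> : nrm (a^*)^-1 = (nrm a)^-1.
  by rewrite -(nrm_conj a) /nrm normfV nrmE -fmorphV.
by rewrite ler_pdivrMr// leNgt => /negP; apply; nra.
Qed.

Lemma pairYX_opnorm (a : C) : invertible (pairX a A1) ->
  (forall z, nrm (pairY a A2 z) <= nrm (pairX a A1 z)) ->
  opnorm (pairY a A2 \o inv_op (pairX a A1)) <= 1.
Proof.
move=> iX YX; apply: opnorm_le => // z; rewrite mul1r.
by rewrite -{2}(inv_opVK iX z) /=.
Qed.

Lemma pairT_positive (a : C) :
  (forall z, nrm (pairY a A2 z) <= nrm (pairX a A1 z)) ->
  positive_op (pairT a A1 A2).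
Proof.
move=> YX; split; first exact: pairT_bounded.
move=> z; rewrite pairT_form// !inner_nrm subr_ge0 lecR.
by rewrite le_nrm_sqr.
Qed.

(** If [|Y z| <= d |X z|] with [d < 1], then [T = X^* X - Y^* Y] is at least
    [(1 - d^2) X^* X], which is coercive as [X] is invertible. *)
Lemma pairT_invertible (a : C) : invertible (pairX a A1) ->
  opnorm (pairY a A2 \o inv_op (pairX a A1)) < 1 -> invertible (pairT a A1 A2).
Proof.
set c := opnorm _ => iX c1.
have [M M0 XM] := bounded_ge0 (inv_op_bounded iX).
pose d := Num.max 0 c.
have d0 : 0 <= d by rewrite le_max lexx.
have d1 : d < 1 by rewrite gt_max ltr01.
have YX z : nrm (pairY a A2 z) <= d * nrm (pairX a A1 z).
  have := le_opnorm (pairX a A1 z)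
    (bounded_linear_comp (pairY_bounded a) (inv_op_bounded iX)).
  rewrite /= inv_opK// -/c => /le_trans; apply.
  by rewrite ler_wpM2r ?nrm_ge0// le_max lexx orbT.
have M1 : 0 < M + 1 by rewrite ltr_pwDr.
apply: (@coercive_invertible _ _ _ ((1 - d ^+ 2) / (M + 1) ^+ 2)).
- exact: pairT_bounded.
- by rewrite divr_gt0 ?exprn_gt0// subr_gt0 expr_lt1.
move=> z; apply: le_trans (Re_le_nrm _).
rewrite pairT_form// !inner_nrm -rmorphB /=.
have zX : nrm z <= (M + 1) * nrm (pairX a A1 z).
  have := XM (pairX a A1 z); rewrite inv_opK// => /le_trans; apply.
  by rewrite ler_wpM2r ?nrm_ge0// lerDl.
have zX2 : nrm z ^+ 2 <= (M + 1) ^+ 2 * nrm (pairX a A1 z) ^+ 2.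
  by rewrite -exprMn ler_pXn2r// nnegrE ?nrm_ge0// mulr_ge0 ?nrm_ge0// ltW.
have Y2 : nrm (pairY a A2 z) ^+ 2 <= d ^+ 2 * nrm (pairX a A1 z) ^+ 2.
  by rewrite -exprMn ler_pXn2r// nnegrE ?nrm_ge0// mulr_ge0 ?nrm_ge0.
have d2 : 0 <= 1 - d ^+ 2 by rewrite subr_ge0 expr_le1// ltW.
apply: le_trans (_ : (1 - d ^+ 2) * nrm (pairX a A1 z) ^+ 2 <= _); last by lra.
by rewrite -mulrA ler_wpM2l// ler_pdivrMl// exprn_gt0.
Qed.

End PairTransforms.

(** * The image of a Gamma_3-contraction under an automorphism *)

Section TauImage.
Context (R : realType) (H : hilbertType R).
Local Notation C := R[i].
Context (S1 S2 P : H -> H) (A1 A2 : defect_space P -> defect_space P).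
Hypotheses (hS : Gamma3_contraction S1 S2 P)
  (hA : fundamental_pair S1 S2 P A1 A2) (hcomm : A1 \o A2 = A2 \o A1).

Let D := defect_corestr P.

Let bS1 : bounded_linear S1. Proof. by case: hS => /(_ 0). Qed.
Let bS2 : bounded_linear S2. Proof. by case: hS => /(_ 1). Qed.
Let bP : bounded_linear P. Proof. by case: hS => /(_ 2). Qed.
Let P1 := Gamma3_P_contraction hS.

Let comm i j x : tnth [tuple S1; S2; P] i (tnth [tuple S1; S2; P] j x) =
  tnth [tuple S1; S2; P] j (tnth [tuple S1; S2; P] i x).
Proof. by case: hS => _ /(_ i j)/(congr1 (@^~ x)). Qed.

Let c12 x : S1 (S2 x) = S2 (S1 x). Proof. exact: (comm 0 1). Qed.
Let c1P x : S1 (P x) = P (S1 x). Proof. exact: (comm 0 2). Qed.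
Let c2P x : S2 (P x) = P (S2 x). Proof. exact: (comm 1 2). Qed.
Let cA x : A1 (A2 x) = A2 (A1 x). Proof. exact: (congr1 (@^~ x) hcomm). Qed.

Let bA1 : bounded_linear A1. Proof. by case: hA. Qed.
Let bA2 : bounded_linear A2. Proof. by case: hA. Qed.
Let AD1 : fundamental_eq D A1 S1 S2 P.
Proof. by have /(fundamental_pairP bP P1 _ _ bS1 bS2)[] := hA. Qed.
Let AD2 : fundamental_eq D A2 S2 S1 P.
Proof. by have /(fundamental_pairP bP P1 _ _ bS1 bS2)[] := hA. Qed.

Let dD : dense_range D. Proof. exact: defect_corestr_dense. Qed.
Let DD : forall x y, inner (D x) (D y) = inner x y - inner (P x) (P y).
Proof. exact: defect_corestr_form. Qed.

Let lt1_gt0 (a : C) : `|a| < 1 -> 0 < 1 - nrm a ^+ 2.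
Proof.
by rewrite nrmE ltcR => a1; rewrite subr_gt0 expr_lt1// nrm_ge0.
Qed.

Let coefE (a : C) : 1 - `|a| ^+ 2 = (1 - nrm a ^+ 2)%:C%C.
Proof. by rewrite nrmE rmorphB rmorph1 rmorphXn. Qed.

Let pairT_norm a x : `|a| < 1 ->
  (1 - nrm a ^+ 2)%:C%C * inner (pairT a A1 A2 (D x)) (D x) =
  (nrm (tau_denom a S1 S2 P x) ^+ 2 - nrm (tau_num a S1 S2 P x) ^+ 2)%:C%C.
Proof.
move=> a1; rewrite -coefE.
rewrite (pairT_transfer bA1 bA2 dD c12 c1P c2P cA DD AD1 AD2).
by rewrite !inner_nrm rmorphB.
Qed.

(** On the range of [D] the difference of the squared norms is a positive
    multiple of [|N x|^2 - |M x|^2]. *)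
Lemma pairYX_le_open (a : C) : `|a| < 1 ->
  forall z, nrm (pairY a A2 z) <= nrm (pairX a A1 z).
Proof.
move=> a1.
apply: (dense_nrm_le dD); [exact: pairX_bounded|exact: pairY_bounded|move=> x].
have [_ MN] := Gamma3_vonNeumann hS a1.
rewrite -le_nrm_sqr -subr_ge0 -(pmulr_rge0 _ (lt1_gt0 a1)).
rewrite -lecR rmorphM [X in _ * X]rmorphB /= -!inner_nrm -pairT_form//.
rewrite pairT_norm// ler0c subr_ge0 le_nrm_sqr.
exact: MN.
Qed.

Section Transform.
Context (a b : C) (a1 : `|a| < 1) (b1 : `|b| = 1).
Hypotheses (pT : positive_op (pairT a A1 A2)) (iT : invertible (pairT a A1 A2)).

Let N := tau_denom a S1 S2 P.
Let M := tau_num a S1 S2 P.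
Let Rv := inv_op N.
Let S1t := tau1 a b S1 S2 P.
Let S2t := tau2 a b S1 S2 P.
Let Pt := tau3 a b S1 S2 P.
Let T := pairT a A1 A2.
Let Tmh := sqrt_op (inv_op T).

Let iN : invertible N. Proof. by have [] := Gamma3_vonNeumann hS a1. Qed.
Let bR : bounded_linear Rv. Proof. exact: inv_op_bounded. Qed.

Let bS1t : bounded_linear S1t.
Proof.
apply: bounded_linear_comp => //; do ?[assumption|apply: bounded_linearD
  |apply: bounded_linearN|apply: bounded_linearZ|exact: bounded_linear_id].
Qed.

Let bS2t : bounded_linear S2t.
Proof.
apply: bounded_linear_comp => //; do ?[assumption|apply: bounded_linearD
  |apply: bounded_linearN|apply: bounded_linearZ|exact: bounded_linear_id].
Qed.

Let bPt : bounded_linear Pt.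
Proof.
apply: bounded_linear_comp => //; do ?[assumption|apply: bounded_linearD
  |apply: bounded_linearN|apply: bounded_linearZ|exact: bounded_linear_id].
Qed.

Let S1tE x : S1t x = b *: tau1_num a S1 S2 P (Rv x). Proof. by []. Qed.
Let S2tE x : S2t x = b ^+ 2 *: tau2_num a S1 S2 P (Rv x). Proof. by []. Qed.
Let PtE x : Pt x = b ^+ 3 *: M (Rv x). Proof. by []. Qed.

Let bb : b * b^* = 1. Proof. by rewrite -normCK b1 expr1n. Qed.

Let nrm_Pt x : nrm (Pt x) = nrm (M (Rv x)).
Proof.
have nb : nrm b = 1 by rewrite /nrm b1.
by rewrite PtE nrmZ !exprS !nrmM nb nrm1 !mul1r.
Qed.

Let Pt1 x : nrm (Pt x) <= nrm x.
Proof.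
rewrite nrm_Pt -{2}(inv_opVK iN x).
exact: (Gamma3_vonNeumann hS a1).2.
Qed.

Let Dt := defect_corestr Pt.

Let pTmh : positive_op Tmh /\ Tmh \o Tmh = inv_op T.
Proof. by apply/sqrt_opP/inv_op_positive. Qed.

Let Tmh2 z : Tmh (Tmh z) = inv_op T z.
Proof. exact: (congr1 (@^~ z) pTmh.2). Qed.

Let TmhT z : Tmh (Tmh (T z)) = z.
Proof. by rewrite Tmh2 inv_opK. Qed.

(** Injectivity of [Tmh] turns its right inverse [Tmh \o T] into a left
    inverse; [Tmh \o T] serves as the square root of [T]. *)
Let TmhTmh z : Tmh (T (Tmh z)) = z.
Proof.
have inj : injective Tmh.
  by move=> u v /(congr1 (T \o Tmh)); rewrite /= !Tmh2 !inv_opVK.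
by apply: inj; rewrite TmhT.
Qed.

Let c : C := (Num.sqrt (1 - nrm a ^+ 2))%:C%C.

Let cc : c * c = 1 - `|a| ^+ 2.
Proof.
by rewrite coefE -rmorphM -expr2 sqr_sqrtr// ltW// lt1_gt0.
Qed.

Let cJ : c^* = c. Proof. by rewrite conj_Creal ?complex_real. Qed.

(** With [R] the inverse of [N], [D_Ptau^2 = c^2 R^* D_P T D_P R]; therefore
    [W = c T^(1/2) D_P R] has the same norms as [D_Ptau], and the unitary is the
    one that carries [D_Ptau] to [W]. *)
Let W x := c *: Tmh (T (D (Rv x))).

Let TmhW x : Tmh (W x) = c *: D (Rv x).
Proof. by rewrite /W (linZ pTmh.1.1.1) TmhT. Qed.

Let linD : linear D. Proof. exact: (defect_corestr_bounded bP P1).1. Qed.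

Let bW : bounded_linear W.
Proof.
apply: bounded_linearZ; apply: (bounded_linear_comp pTmh.1.1).
apply: (bounded_linear_comp pT.1); apply: bounded_linear_comp => //.
exact: defect_corestr_bounded.
Qed.

Let nrmW x : nrm (Dt x) = nrm (W x).
Proof.
suff e : nrm (Dt x) ^+ 2 = nrm (W x) ^+ 2.
  by apply/eqP; rewrite eq_le -!le_nrm_sqr e lexx.
apply: complexI; rewrite -!inner_nrm (defect_corestr_form bPt Pt1).
rewrite /W innerZl innerZr cJ mulrA cc coefE.
rewrite (positive_sym pTmh.1) TmhT -/T.
have -> : inner (T (D (Rv x))) (D (Rv x)) =
    inner (pairT a A1 A2 (D (Rv x))) (D (Rv x)) by [].
rewrite pairT_norm// -/N -/M inv_opVK// !inner_nrm nrm_Pt.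
by rewrite rmorphB.
Qed.

Let dW : dense_range W.
Proof.
have c0 : c != 0.
  apply: contraTneq (lt1_gt0 a1) => c0.
  by rewrite -ltcR -coefE -cc c0 mul0r ltxx.
pose Z z := c *: Tmh (T z).
have bZ : bounded_linear Z.
  by apply/bounded_linearZ/(bounded_linear_comp pTmh.1.1)/pT.1.
have dZ : dense_range Z.
  apply: (@surjective_dense _ _ _ _ (fun z => c^-1 *: Tmh z)) => z.
  rewrite /Z (linZ (pT.1.1 : linear T)) (linZ pTmh.1.1.1) TmhTmh scalerA.
  by rewrite mulfV// scale1r.
have bD : bounded_linear D by exact: defect_corestr_bounded.
apply: (@dense_range_comp _ _ _ _ (D \o Rv) Z) => //.
apply: dense_range_comp => //.
exact: (surjective_dense (inv_opK iN)).
Qed.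

(** Since [Tmh U D_Ptau = c D_P R], the proposed operators satisfy the
    fundamental equations of the image by the identities for
    [N^* L_1 - L_2^* M] and [N^* L_2 - L_1^* M]; density of the range of
    [D_Ptau] makes the solution unique. *)
Lemma tau_fundamental_pair_unitary :
  exists U : defect_space Pt -> defect_space P, unitary U /\
    forall B1 B2 : defect_space Pt -> defect_space Pt,
      fundamental_pair S1t S2t Pt B1 B2 <->
      B1 = adj U \o Tmh \o (b *: pairG1 a A1 A2) \o Tmh \o U /\
      B2 = adj U \o Tmh \o (b ^+ 2 *: pairG2 a A1 A2) \o Tmh \o U.
Proof.
have bDt := defect_corestr_bounded bPt Pt1.
have dDt := @defect_corestr_dense _ _ Pt.
have [U [uU UD]] := unitary_extension bDt.1 bW.1 nrmW dDt dW.
exists U; split=> // B1 B2; have [bU _ _] := uU.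
have TmhU x : Tmh (U (Dt x)) = c *: D (Rv x) by rewrite UD TmhW.
have conj_form (G : defect_space P -> defect_space P) x y : linear G ->
    inner ((adj U \o Tmh \o G \o Tmh \o U) (Dt x)) (Dt y) =
    (1 - `|a| ^+ 2) * inner (G (D (Rv x))) (D (Rv y)).
  move=> linG; rewrite /= (adjPr bU) (positive_sym pTmh.1) !TmhU (linZ linG).
  by rewrite innerZl innerZr cJ mulrA cc.
have bA1' := adj_bounded bA1; have bA2' := adj_bounded bA2.
have bQ : bounded_linear (pairQ A1 A2).
  by apply: bounded_linearB; exact: bounded_linear_comp.
have bG1 : bounded_linear (b *: pairG1 a A1 A2).
  rewrite /pairG1; do ?[assumption|apply: bounded_linearD
  |apply: bounded_linearN|apply: bounded_linearZ|exact: bounded_linear_id].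
have bG2 : bounded_linear (b ^+ 2 *: pairG2 a A1 A2).
  rewrite /pairG2; do ?[assumption|apply: bounded_linearD
  |apply: bounded_linearN|apply: bounded_linearZ|exact: bounded_linear_id].
have bF G : bounded_linear G -> bounded_linear (adj U \o Tmh \o G \o Tmh \o U).
  move=> bG; have bT := pTmh.1.1; have bU' := adj_bounded bU.
  by do ?[assumption|apply: bounded_linear_comp].
have b3 : b ^+ 3 * (b^* * b^*) = b.
  by rewrite !exprS expr0 mulr1 mulrACA bb mulrA mul1r -mulrA bb mulr1.
have b2 : b ^+ 3 * b^* = b ^+ 2 by rewrite [in LHS]exprSr -mulrA bb mulr1.
have F1 : fundamental_eq Dt (adj U \o Tmh \o (b *: pairG1 a A1 A2) \o Tmh \o U)
    S1t S2t Pt.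
  move=> x y; rewrite (conj_form _ _ _ bG1.1) !fctE innerZl mulrCA.
  rewrite (pairG1_transfer bA1 bA2 dD c12 c1P c2P cA DD AD1 AD2).
  rewrite -/N -/M inv_opVK// S1tE S2tE PtE !innerZl innerZr mulrBr.
  by rewrite rmorphXn/= [b^* ^+ 2]expr2 [in RHS]mulrA b3.
have F2 : fundamental_eq Dt
    (adj U \o Tmh \o (b ^+ 2 *: pairG2 a A1 A2) \o Tmh \o U)
    S2t S1t Pt.
  move=> x y; rewrite (conj_form _ _ _ bG2.1) !fctE innerZl mulrCA.
  rewrite (pairG2_transfer bA1 bA2 dD c12 c1P c2P cA DD AD1 AD2).
  rewrite -/N -/M inv_opVK// S1tE S2tE PtE !innerZl innerZr mulrBr.
  by rewrite [in RHS]mulrA b2.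
rewrite (fundamental_pairP bPt Pt1 _ _ bS1t bS2t); split.
  move=> [bB1 bB2 BD1 BD2]; split.
    by apply: (fundamental_eq_unique dDt bB1 _ BD1 F1); exact: bF.
  by apply: (fundamental_eq_unique dDt bB2 _ BD2 F2); exact: bF.
by move=> [-> ->]; split=> //; exact: bF.
Qed.

End Transform.
End TauImage.

(** * The theorem *)

Theorem theorem4p3 (R : realType) (H : hilbertType R) (S1 S2 P : H -> H)
    (A1 A2 : defect_space P -> defect_space P)
    (hS : Gamma3_contraction S1 S2 P)
    (hA : fundamental_pair S1 S2 P A1 A2)
    (hcomm : A1 \o A2 = A2 \o A1) :
  let X := fun a : R[i] => (1 + `|a| ^+ 2) *: idfun - a^* *: A1 in
  let Y := fun a : R[i] => a *: idfun - a^* *: A2 in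
  [/\ (forall a : R[i], `|a| <= 1 ->
         loewner_le ((a^* *: idfun - a *: adj A2) \o (a *: idfun - a^* *: A2))
           (((1 + `|a| ^+ 2) *: idfun - a *: adj A1)
              \o ((1 + `|a| ^+ 2) *: idfun - a^* *: A1))),
      (spectral_radius A1 <= 2 ->
         forall a : R[i], `|a| < 1 ->
           invertible (X a) /\ opnorm (Y a \o inv_op (X a)) <= 1) &
      (spectral_radius A1 <= 2 ->
       (forall a : R[i], `|a| < 1 -> opnorm (Y a \o inv_op (X a)) < 1) ->
       forall a b : R[i], `|a| < 1 -> `|b| = 1 ->
       let S1t := tau1 a b S1 S2 P in
       let S2t := tau2 a b S1 S2 P in
       let Pt := tau3 a b S1 S2 P in
       let Q := (adj A1 \o A1) - (adj A2 \o A2) in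
       let T := (1 + `|a| ^+ 2 + `|a| ^+ 4) *: idfun
                - (1 + `|a| ^+ 2) *: (a *: adj A1 + a^* *: A1)
                + (a ^+ 2 *: adj A2 + a^* ^+ 2 *: A2)
                + `|a| ^+ 2 *: Q in
       let Tmh := sqrt_op (inv_op T) in
       [/\ invertible (tau_denom a S1 S2 P),
           positive_op T, invertible T &
           exists U : defect_space Pt -> defect_space P, unitary U /\
             forall B1 B2 : defect_space Pt -> defect_space Pt,
               fundamental_pair S1t S2t Pt B1 B2 <->
               B1 = adj U \o Tmh \o
                    (b *: ((1 + 3 * `|a| ^+ 2) *: A1
                           + (a ^+ 2 * (3 + `|a| ^+ 2)) *: adj A1
                           - (2 * a^*) *: A2 - (2 * a ^+ 3) *: adj A2
                           - (a * (1 + `|a| ^+ 2)) *: Q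
                           - (3 * a * (1 + `|a| ^+ 2)) *: idfun)) \o Tmh \o U
               /\
               B2 = adj U \o Tmh \o
                    (b ^+ 2 *: (- (2 *: (a *: A1 + a ^+ 3 *: adj A1))
                                + A2 + a ^+ 4 *: adj A2 + a ^+ 2 *: Q
                                + (3 * a ^+ 2) *: idfun)) \o Tmh \o U])].
Proof.
move=> X Y.
have [bA1 bA2 _ _] := hA.
have YX := pairYX_le_open hS hA hcomm.
have YXc := pairYX_le_closed YX.
split=> [a a1|r2 a a1|r2 YX1 a b a1 b1].
- have bX := pairX_bounded bA1 a; have bY := pairY_bounded bA2 a.
  have adjX : adj (pairX a A1) = (1 + `|a| ^+ 2) *: idfun - a *: adj A1.
    apply: adj_unique => // x y; rewrite /pairX !fctE /= !innerE (adjP bA1).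
    by rewrite rmorphD rmorph1 rmorphXn/= conj_normC.
  have adjY : adj (pairY a A2) = a^* *: idfun - a *: adj A2.
    apply: adj_unique => // x y.
    by rewrite /pairY !fctE /= !innerE (adjP bA2) conjCK.
  rewrite -adjX -adjY; split.
    apply: bounded_linearB; apply: bounded_linear_comp => //.
      exact: adj_bounded.
    exact: adj_bounded.
  move=> x; rewrite fctE innerBl /= (adjPr bX) (adjPr bY) !inner_nrm.
  by rewrite subr_ge0 lecR le_nrm_sqr; exact: YXc.
- have iX := pairX_invertible bA1 r2 a1.
  by split=> //; exact: pairYX_opnorm (YX a a1).
have iX := pairX_invertible bA1 r2 a1.
have pT := pairT_positive bA1 bA2 (YX a a1).
have iT := pairT_invertible bA1 bA2 iX (YX1 a a1).
move=> S1t S2t Pt Q T Tmh; split=> //.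
  by have [] := Gamma3_vonNeumann hS a1.
exact: (tau_fundamental_pair_unitary hS hA hcomm a1 b1 pT iT).
Qed.
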